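(* Let $\psi:\mathbb{R}^+\to\mathbb{R}^+$ be an increasing (in the wide sense, i.e. nondecreasing) map of $\mathbb{R}^+=[0,\infty)$ onto $\mathbb{R}^+$ such that $\lim_{x\to 0}\psi(x)/x^2=0$. Then: (a) There exists a Borel probability measure $\mu$ on $\mathbb{D}$, singular with respect to the Haar probability measure of $\mathbb{D}$, such that all partial sums of its Fourier–Walsh series are positive, i.e. $\sum_{n=0}^{N}\widehat\mu(n)w_n(x)\ge 0$ for every integer $N\ge 0$ and every $x\in\mathbb{D}$, and whose Fourier–Walsh coefficients $\widehat\mu(n)=\int_{\mathbb{D}} w_n\,d\mu$ satisfy $$\sum_{n=0}^\infty \psi(|\widehat\mu(n)|)<\infty .$$ (b) The same holds for Fourier series and Fourier coefficients in the usual sense: there exists a Borel probability measure $\mu$ on $[0,1]$, singular with respect to Lebesgue measure, such that all partial sums of its Fourier series are positive, i.e. $\sum_{|n|\le N}\widehat\mu(n)e^{2\pi i n t}\ge 0$ for every integer $N\ge 0$ and every $t\in[0,1]$, and whose Fourier coefficients $\widehat\mu(n)=\int_{[0,1]} e^{-2\pi i n t}\,d\mu(t)$ satisfy $$\sum_{n=0}^\infty \psi(|\widehat\mu(n)|)<\infty .$$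
   Context: $\mathbb{D}=\{-1,1\}^{\mathbb{N}^*}$ with $\mathbb{N}^*=\{1,2,3,\ldots\}$, regarded as a compact multiplicative group (product topology); it serves as the model of $[0,1]$ on which Walsh functions are defined. The coordinate functions $r_1,r_2,\ldots$ on $\mathbb{D}$ are the Rademacher functions: $r_j(x)=x_j$. For an integer $n\ge 0$ with binary expansion $n=\sum_{j\ge1}\alpha_j 2^{j-1}$, $\alpha_j\in\{0,1\}$ (finitely many nonzero), the Walsh function $w_n$ is $w_n=\prod_{j\ge 1} r_j^{\alpha_j}$. Thus $w_0=1$, $w_1=r_1$, $w_2=r_2$, $w_3=r_1r_2$, $w_4=r_3$, etc. The Fourier–Walsh series of a measure $\mu$ on $\mathbb{D}$ is $\sum_{n=0}^\infty\widehat\mu(n)w_n$ with $\widehat\mu(n)=\int_{\mathbb{D}} w_n\,d\mu$. ''Positive'' means $\ge 0$. *)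

(* Defs.v *)
From mathcomp Require Import all_boot all_order all_algebra.
From mathcomp Require Import all_classical all_reals all_analysis.
From mathcomp.real_closed Require Import complex.

Set Implicit Arguments.
Unset Strict Implicit.
Unset Printing Implicit Defensive.

Import Order.TTheory GRing.Theory Num.Theory.
Import numFieldNormedType.Exports.

Local Open Scope classical_set_scope.
Local Open Scope ring_scope.

(* The group {-1,1}^N* is represented by the Cantor space: the sign +1 (resp.
   -1) is encoded by false (resp. true), and the coordinate of index j in N*
   is stored at position j - 1. *)
Notation dyadic := (g_sigma_algebraType (@open cantor_space)).

(* The product of the signs (-1)^a and (-1)^b is (-1)^(a (+) b). *)
Definition dyadic_mul (x y : dyadic) : dyadic := fun j => x j (+) y j.

Definition is_haar (R : realType) (h : probability dyadic R) : Prop :=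
  forall (a : dyadic) (A : set dyadic),
    measurable A -> h (dyadic_mul a @^-1` A) = h A.

(* rademacher R j is the Rademacher function r_(j+1). *)
Definition rademacher (R : realType) (j : nat) (x : dyadic) : R :=
  (-1) ^+ (x j : bool).

(* odd (n %/ 2 ^ j) is the coefficient of 2 ^ j in the binary expansion of n;
   it vanishes for j >= n, so the infinite product stops there. *)
Definition walsh (R : realType) (n : nat) (x : dyadic) : R :=
  \prod_(j < n) rademacher R j x ^+ odd (n %/ 2 ^ j).

Definition walsh_coef (R : realType) (mu : probability dyadic R) (n : nat) : R :=
  (\int[mu]_x walsh R n x)%R.

Definition mutually_singular d (T : measurableType d) (R : realType)
    (mu nu : {measure set T -> \bar R}) : Prop :=
  exists A : set T, [/\ measurable A, mu (~` A) = 0%E & nu A = 0%E].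

Definition expi (R : realType) (theta : R) : R[i] :=
  Complex (cos theta) (sin theta).

Definition cintegral d (T : measurableType d) (R : realType)
    (mu : {measure set T -> \bar R}) (D : set T) (f : T -> R[i]) : R[i] :=
  Complex (\int[mu]_(x in D) complex.Re (f x))%R
          (\int[mu]_(x in D) complex.Im (f x))%R.

Definition fourier_coef (R : realType)
    (mu : probability (measurableTypeR R) R) (n : int) : R[i] :=
  cintegral mu `[0, 1] (fun t : R => expi (- (2 * pi * n%:~R * t))).

(* The index k runs over 0, ..., 2N, so that n = k - N runs over -N, ..., N. *)
Definition fourier_partial_sum (R : realType)
    (mu : probability (measurableTypeR R) R) (N : nat) (t : R) : R[i] :=
  \sum_(k < N.*2.+1) let n : int := k%:Z - N%:Z in
    fourier_coef mu n * expi (2 * pi * n%:~R * t).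

(* Main.v *)
Require Import Defs.
From HB Require Import structures.
From mathcomp Require Import all_boot all_order all_algebra.
From mathcomp Require Import all_classical all_reals all_analysis.
From mathcomp.real_closed Require Import complex.
From mathcomp Require Import measurable_realfun ring lra zify.

Import Order.TTheory GRing.Theory Num.Theory.
Import numFieldNormedType.Exports.

Local Open Scope classical_set_scope.
Local Open Scope ring_scope.

Set Implicit Arguments.
Unset Strict Implicit.
Unset Printing Implicit Defensive.

(** Both measures are Riesz products. Stage [k] multiplies the density [f] built
    so far, a polynomial with [f >= 4 ^- k], by a factor [1 + delta b], where
    the frequencies of [b] are so far apart that the translates by them of the
    spectrum of [f] are disjoint. The function [b] has about [4 ^ m]
    frequencies, with coefficients of size at most [2 ^- m], and all its partial
    sums are bounded by an absolute constant, against which [delta] is chosen.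

    Positivity. A partial sum of the new density is [f] times a partial sum of
    [1 + delta b], hence at least a fixed proportion of [f], plus one incomplete
    translate of the spectrum of [f]. The latter is at most [2 ^- m] times the
    number of coefficients of [f], which is negligible against [4 ^- k] once [m]
    is large; see [walsh_riesz_stage] and [trig_stage].

    Summability. If the length of the spectrum of [f] is [L], stage [k] creates at
    most [2 * L * 4 ^ m] coefficients, each of them at most [2 ^- m]. Since
    [psi (2 ^- m) * 4 ^ m] tends to 0, a large [m] makes their contribution at
    most [2 ^- k]; see [scale_choice].

    Singularity. The functions [b] of the successive stages are uncorrelated
    with a common positive mean for the product measure, and orthogonal for
    Haar or Lebesgue measure, where their mean is 0; the law of large numbers
    separates the two measures, by [weak_law_singular].

    On the dyadic group, [b] is a fresh Rademacher function times a bent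
    function, whose partial sums are bounded by 3 ([wsum_bent_le]). Since [b]
    takes the values 1 and -1 only, the measure is the image of Haar measure
    under a map that biases one bit in each block of variables ([riesz_map]).
    On the interval, [b] is a Rudin-Shapiro cosine polynomial ([shapiro_le]).
    The measure is given by the uniform limit of the distribution functions of
    the partial products, and its Fourier coefficients are computed by
    comparison of Riemann-Stieltjes sums ([stieltjes_limit], [int_cos]). *)

(** * Block sums, and the choice of scales *)

Lemma sum_blocks (V : nmodType) (L j i : nat) (h : nat -> nat -> V) :
  (0 < L)%N -> (i <= L)%N ->
  \sum_(n < j * L + i) h (n %/ L)%N (n %% L)%N =
  \sum_(p < j) \sum_(r < L) h p r + \sum_(r < i) h j r.
Proof.
move=> L0; have short k i' : (i' <= L)%N ->
    \sum_(k * L <= n < k * L + i') h (n %/ L)%N (n %% L)%N = \sum_(r < i') h k r.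
  move=> i'L; rewrite -{1}[(k * L)%N]add0n big_addn addKn big_mkord.
  apply: eq_bigr => r _; have rL : (r < L)%N by exact: leq_trans (ltn_ord r) i'L.
  by rewrite addnC divnMDl// divn_small// addn0 modnMDl modn_small.
move=> iL; have full : \sum_(n < j * L) h (n %/ L)%N (n %% L)%N =
    \sum_(p < j) \sum_(r < L) h p r.
  elim: j => [|j IH]; first by rewrite !big_ord0.
  rewrite big_ord_recr/= -IH -short// -!(big_mkord xpredT (fun n => h (n %/ L)%N (n %% L)%N)).
  by rewrite (@big_cat_nat _ _ _ (j * L)%N)//= mulSn addnC// leq_addr.
rewrite -full -short// -!(big_mkord xpredT (fun n => h (n %/ L)%N (n %% L)%N)).
by rewrite (@big_cat_nat _ _ _ (j * L)%N)//= leq_addr.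
Qed.

Lemma half_powers_small (R : realType) (eta : R) : 0 < eta ->
  exists m0, forall m, (m0 <= m)%N -> 2^-1 ^+ m < eta.
Proof.
move=> eta0; have : 2^-1 ^+ m @[m --> \oo] --> (0 : R).
  by apply: cvg_expr; rewrite ger0_norm ?invr_ge0// invf_lt1// ltr1n.
move=> /cvgr0Pnorm_lt /(_ eta eta0) [m0 _ H]; exists m0 => m /H /=.
by rewrite ger0_norm// exprn_ge0// invr_ge0.
Qed.

(** The hypothesis that psi is small compared with the square enters the
    construction only through this choice: a flat block of frequencies at
    stage k is spread over so many terms that they contribute a summable
    amount, whatever the number [L] of coefficients already present. *)
Lemma scale_choice (R : realType) (psi : R -> R) :
  psi x / x ^+ 2 @[x --> 0^'+] --> (0 : R) ->
  exists m : nat -> nat -> nat, forall k L,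
    psi (2^-1 ^+ m k L) * (2 * L * 4 ^ m k L)%:R <= 2^-1 ^+ k /\
    2^-1 ^+ m k L * L%:R <= 4^-1 ^+ k :> R.
Proof.
move=> small; suff H k L : exists m,
    psi (2^-1 ^+ m) * (2 * L * 4 ^ m)%:R <= 2^-1 ^+ k /\
    2^-1 ^+ m * L%:R <= 4^-1 ^+ k :> R.
  have [f fP] := choice (fun kL : nat * nat => H kL.1 kL.2).
  by exists (fun k L => f (k, L)) => k L; exact: (fP (k, L)).
have q20 : 0 < 2^-1 ^+ k :> R by rewrite exprn_gt0// invr_gt0.
have q40 : 0 < 4^-1 ^+ k :> R by rewrite exprn_gt0// invr_gt0.
move: (2^-1 ^+ k) (4^-1 ^+ k) q20 q40 => q2 q4 q20 q40.
pose L1 : R := L.*2.+1%:R; have L10 : 0 < L1 by rewrite ltr0n.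
pose e2 : R := q2 / L1; pose e4 : R := q4 / L1.
have e20 : 0 < e2 by rewrite divr_gt0.
have e40 : 0 < e4 by rewrite divr_gt0.
have LL1 : L%:R <= L1 by rewrite ler_nat leqW// -addnn leq_addr.
move: small => /cvgr0Pnorm_le /(_ e2 e20) [d /= d0 Hd].
have [m1 Hm1] := half_powers_small d0; have [m2 Hm2] := half_powers_small e40.
exists (maxn m1 m2); set m := maxn m1 m2.
have kap0 : 0 < 2^-1 ^+ m :> R by rewrite exprn_gt0// invr_gt0.
have {}Hm1 := Hm1 m (leq_maxl _ _); have {}Hm2 := Hm2 m (leq_maxr _ _).
have psiS : psi (2^-1 ^+ m) <= e2 * (2^-1 ^+ m) ^+ 2.
  rewrite -ler_pdivrMr ?exprn_gt0//; apply: le_trans (ler_norm _) _.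
  by apply: Hd => //=; rewrite sub0r normrN ger0_norm// ltW.
(* The number of coefficients compensates the square of their size. *)
have sq4 : (2^-1 ^+ m) ^+ 2 * 4 ^+ m = 1 :> R.
  by rewrite exprAC -exprMn expr2 -invfM -natrM mulVf ?expr1n// pnatr_eq0.
split.
- rewrite natrM natrX.
  apply: (@le_trans _ _ (e2 * (2^-1 ^+ m) ^+ 2 * ((2 * L)%:R * 4 ^+ m))).
    by rewrite ler_wpM2r// mulr_ge0// exprn_ge0.
  rewrite (_ : _ * (_ * _) = e2 * (2 * L)%:R * ((2^-1 ^+ m) ^+ 2 * 4 ^+ m)); last by ring.
  rewrite sq4 mulr1 /e2 -mulrA ler_piMr ?(ltW q20)//.
  by rewrite mulrC ler_pdivrMr// mul1r ler_nat mul2n leqnSn.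
- have <- : e4 * L1 = q4 by rewrite divfK// lt0r_neq0.
  by rewrite ler_pM// ltW.
Qed.

Lemma geometric_increments (R : realType) (u : nat -> R) :
  (forall k, u k.+1 <= u k + 2^-1 ^+ k) -> forall k, u k <= u 0%N + 2.
Proof.
move=> H k; suff : u k <= u 0%N + 2 * (1 - 2^-1 ^+ k).
  move=> /le_trans; apply; rewrite lerD2l// mulrBr mulr1 lerBlDr lerDl.
  by rewrite mulr_ge0// exprn_ge0// invr_ge0.
elim: k => [|k IH]; first by rewrite expr0 subrr mulr0 addr0.
by apply: le_trans (H k) _; rewrite exprS; move: IH; set c := 2^-1 ^+ k; lra.
Qed.

Lemma bounded_nneseries (R : realType) (g : nat -> R) (N : nat -> nat) (B : R) :
  (forall n, 0 <= g n) -> (forall k, (k <= N k)%N) ->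
  (forall k, \sum_(n < N k) g n <= B) ->
  (\sum_(n <oo) (g n)%:E < +oo)%E.
Proof.
move=> g0 kN gB; apply: (@le_lt_trans _ _ B%:E); last exact: ltry.
apply: lime_le; first by apply: is_cvg_nneseries => n _ _; rewrite lee_fin.
apply: nearW => n; rewrite sumEFin lee_fin big_mkord; apply: le_trans (gB n).
rewrite -!(big_mkord xpredT g) (@big_cat_nat _ _ _ n 0 (N n))//= lerDl.
by apply: sumr_ge0.
Qed.

(** * Singularity by the weak law of large numbers *)

Section weak_law.
Context d (T : measurableType d) (R : realType).
Implicit Types (m : {measure set T -> \bar R}) (D : set T).

Lemma integrable_of_bounded m D (f : T -> R) (C : R) :
  measurable D -> m D = 1%E -> measurable_fun D f ->
  (forall x, D x -> `|f x| <= C) -> m.-integrable D (EFin \o f).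
Proof.
move=> mD mD1 mf fC; apply: measurable_bounded_integrable => //.
  by rewrite mD1 ltry.
by exists C; split; [exact: num_real|move=> x xC y Dy /=; exact: le_trans (fC _ Dy) (ltW xC)].
Qed.

Lemma measurable_superlevel D (f : T -> R) (c : R) :
  measurable D -> measurable_fun D f -> measurable (D `&` [set x | c <= f x]).
Proof.
move=> mD mf; have := mf mD `[c, +oo[%classic (measurable_itv _).
by congr measurable; apply/seteqP; split => x [Dx] /=; rewrite in_itv/= andbT.
Qed.

Lemma Rintegral_sum_bounded m D n (f : nat -> T -> R) (C : nat -> R) :
  measurable D -> m D = 1%E -> (forall i, measurable_fun D (f i)) ->
  (forall i x, D x -> `|f i x| <= C i) ->
  (\int[m]_(x in D) \sum_(i < n) f i x)%R = \sum_(i < n) (\int[m]_(x in D) f i x)%R.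
Proof.
move=> mD mD1 mf fC; elim: n => [|n IH].
  rewrite big_ord0; under eq_Rintegral do rewrite big_ord0.
  by rewrite Rintegral_cst// mul0r.
rewrite big_ord_recr/= -IH; under eq_Rintegral do rewrite big_ord_recr/=.
apply: RintegralD => //; last exact: (integrable_of_bounded mD mD1 (mf n) (fC n)).
apply: (@integrable_of_bounded _ _ _ (\sum_(i < n) C i)) => //.
  exact: measurable_sum.
by move=> x Dx; apply: le_trans (ler_norm_sum _ _ _) _; apply: ler_sum => i _; exact: fC.
Qed.

(** Pairwise orthogonality makes the second moment additive: it grows like [n],
    whereas the square of a sum of [n] terms is a priori of order [n ^ 2]. *)
Lemma orthogonal_second_moment m D (Y : nat -> T -> R) (C : R) n :
  measurable D -> m D = 1%E ->
  (forall l, measurable_fun D (Y l)) -> (forall l x, D x -> `|Y l x| <= C) ->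
  (forall k l, (k < l)%N -> (\int[m]_(x in D) (Y k x * Y l x))%R = 0) ->
  (\int[m]_(x in D) (\sum_(l < n) Y l x) ^+ 2)%R <= n%:R * C ^+ 2.
Proof.
move=> mD mD1 mY YC Y0.
have mS k : measurable_fun D (fun x => \sum_(l < k) Y l x) by exact: measurable_sum.
have SC k x : D x -> `|\sum_(l < k) Y l x| <= k%:R * C.
  move=> Dx; apply: le_trans (ler_norm_sum _ _ _) _.
  by rewrite mulr_natl -[k in leRHS]card_ord -sumr_const; apply: ler_sum => i _; exact: YC.
elim: n => [|n IH].
  under eq_Rintegral do rewrite big_ord0 expr0n/=.
  by rewrite Rintegral_cst// !mul0r.
under eq_Rintegral do rewrite big_ord_recr/= sqrrD -addrA.
have i1 : m.-integrable D (EFin \o (fun x => (\sum_(l < n) Y l x) ^+ 2)).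
  apply: (@integrable_of_bounded _ _ _ ((n%:R * C) ^+ 2)) => //.
    exact: measurable_funX.
  by move=> x Dx; rewrite normrX lerXn2r ?nnegrE ?SC// (le_trans _ (SC n x Dx)).
have i2 : m.-integrable D (EFin \o (fun x => (\sum_(l < n) Y l x) * Y n x)).
  apply: (@integrable_of_bounded _ _ _ (n%:R * C * C)) => //.
    exact: measurable_funM.
  by move=> x Dx; rewrite normrM ler_pM ?SC ?YC.
have i3 : m.-integrable D (EFin \o (fun x => Y n x ^+ 2)).
  apply: (@integrable_of_bounded _ _ _ (C ^+ 2)) => //.
    exact: measurable_funX.
  by move=> x Dx; rewrite normrX lerXn2r ?nnegrE ?YC// (le_trans _ (YC n x Dx)).
have i22 : m.-integrable D (EFin \o (fun x => (\sum_(l < n) Y l x) * Y n x *+ 2)).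
  rewrite (_ : EFin \o _ = (fun x => 2%:E * ((\sum_(l < n) Y l x) * Y n x)%:E)%E).
    exact: integrableZl.
  by apply/funext => x /=; rewrite -EFinM mulr_natl.
have -> : (\int[m]_(x in D) ((\sum_(l < n) Y l x) ^+ 2 +
    ((\sum_(l < n) Y l x) * Y n x *+ 2 + Y n x ^+ 2)))%R =
    (\int[m]_(x in D) (\sum_(l < n) Y l x) ^+ 2)%R + (\int[m]_(x in D) Y n x ^+ 2)%R.
  rewrite RintegralD//; last first.
    rewrite (_ : EFin \o _ = (fun x => ((\sum_(l < n) Y l x) * Y n x *+ 2)%:E +
       (Y n x ^+ 2)%:E)%E) //.
    exact: integrableD.
  congr (_ + _); rewrite RintegralD//.
  under eq_Rintegral do rewrite -mulr_natr mulr_suml mulr_suml.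
  rewrite (@Rintegral_sum_bounded _ _ _ (fun l x => Y l x * Y n x * 2) (fun=> C * C * 2))//.
  - rewrite big1 ?add0r// => i _; rewrite RintegralZr//; last first.
      apply: (@integrable_of_bounded _ _ _ (C * C)) => //; first exact: measurable_funM.
      by move=> x Dx; rewrite normrM ler_pM ?YC.
    by rewrite Y0// mul0r.
  - by move=> i; apply: measurable_funM => //; exact: measurable_funM.
  - by move=> i x Dx; rewrite normrM (@ger0_norm _ 2)// ler_wpM2r// normrM ler_pM ?YC.
rewrite -natr1 mulrDl mul1r lerD//.
have -> : C ^+ 2 = (\int[m]_(x in D) (cst (C ^+ 2) x))%R.
  by rewrite Rintegral_cst// mD1/= mulr1.
apply: le_Rintegral => //.
  apply: (@integrable_of_bounded _ _ _ (C ^+ 2)) => // x Dx.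
  by rewrite /cst ger0_norm// sqr_ge0.
move=> x Dx /=; rewrite -[leLHS]real_normK ?num_real//.
by rewrite lerXn2r ?nnegrE ?YC// (le_trans _ (YC n x Dx)).
Qed.

Lemma chebyshev_sum m D (Y : nat -> T -> R) (C t : R) n :
  measurable D -> m D = 1%E ->
  (forall l, measurable_fun D (Y l)) -> (forall l x, D x -> `|Y l x| <= C) ->
  (forall k l, (k < l)%N -> (\int[m]_(x in D) (Y k x * Y l x))%R = 0) ->
  0 < t -> (0 < n)%N ->
  (m (D `&` [set x | n%:R * t <= `|\sum_(l < n) Y l x|]%R) <=
    (C ^+ 2 / t ^+ 2 / n%:R)%:E)%E.
Proof.
move=> mD mD1 mY YC Y0 t0 n0.
have mS : measurable_fun D (fun x => \sum_(l < n) Y l x) by exact: measurable_sum.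
set E := D `&` _.
have n0' : 0 < n%:R :> R by rewrite ltr0n.
have e0 : 0 < (n%:R * t) ^+ 2 by rewrite exprn_gt0// mulr_gt0.
have SC x : D x -> `|\sum_(l < n) Y l x| <= n%:R * C.
  move=> Dx; apply: le_trans (ler_norm_sum _ _ _) _.
  by rewrite mulr_natl -[n in leRHS]card_ord -sumr_const; apply: ler_sum => i _; exact: YC.
have mE : measurable E.
  by apply: measurable_superlevel => //; exact: measurableT_comp.
have iS : m.-integrable D (EFin \o (fun x => (\sum_(l < n) Y l x) ^+ 2)).
  apply: (@integrable_of_bounded _ _ _ ((n%:R * C) ^+ 2)) => //.
    exact: measurable_funX.
  by move=> x Dx; rewrite normrX lerXn2r ?nnegrE ?SC// (le_trans _ (SC x Dx)).
have key : ((((n%:R * t) ^+ 2)%:E * m E)%E <= (n%:R * C ^+ 2)%:E)%E.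
  apply: (@le_trans _ _ (\int[m]_(x in E) ((\sum_(l < n) Y l x) ^+ 2)%:E)%E).
    rewrite -integral_cst//; apply: ge0_le_integral => //.
    - by move=> x _ /=; rewrite lee_fin ltW.
    - apply/measurable_EFinP; apply: measurable_funX.
      by apply: measurable_funS mS => // x [].
    - move=> x [Dx /= h]; rewrite lee_fin -[leRHS]real_normK ?num_real//.
      by rewrite lerXn2r// nnegrE// mulr_ge0// ltW.
  apply: (@le_trans _ _ (\int[m]_(x in D) ((\sum_(l < n) Y l x) ^+ 2)%:E)%E).
    apply: ge0_subset_integral => //.
    - by case/integrableP : iS.
    - by move=> x _; rewrite lee_fin sqr_ge0.
    - by move=> x [].
  rewrite -[X in (X <= _)%E]fineK; last exact: integrable_fin_num.
  by rewrite lee_fin; exact: orthogonal_second_moment.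
have -> : C ^+ 2 / t ^+ 2 / n%:R = (n%:R * C ^+ 2) / (n%:R * t) ^+ 2.
  by field; rewrite !gt_eqF.
by rewrite mulrC EFinM lee_pdivlMl.
Qed.

Lemma geometric_measures_summable m (F : nat -> set T) (c : R) :
  0 <= c -> (forall j, m (F j) <= (c / (2 ^ j)%:R)%:E)%E ->
  (\sum_(j <oo) m (F j) < +oo)%E.
Proof.
move=> c0 H; apply: (@le_lt_trans _ _ (\sum_(j <oo) (c / (2 ^ j)%:R)%:E)%E).
  by apply: lee_nneseries => j.
have g0 j : 0 <= c / (2 ^ j)%:R :> R by rewrite divr_ge0.
apply: (@bounded_nneseries _ _ id (c * 2)) => // k.
have -> : \sum_(n < k) c / (2 ^ n)%:R = c * \sum_(n < k) 2^-1 ^+ n :> R.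
  by rewrite mulr_sumr; apply: eq_bigr => i _; rewrite natrX exprVn.
apply: ler_wpM2l => //.
have := @geometric_increments R (fun k => \sum_(n < k) 2^-1 ^+ n).
by rewrite /= big_ord0 add0r; apply => j; rewrite big_ord_recr.
Qed.

(** The average of the first [n] variables is close to [0] for [nu] and to [a]
    for [mu], up to a set of measure O(1/n). Along [n = 2 ^ j] these measures
    are summable, so by Borel-Cantelli the set [A] of points where the average
    is at least [a / 2] infinitely often separates the two measures. *)
Lemma weak_law_singular (mu nu : {measure set T -> \bar R}) D
    (X : nat -> T -> R) (a C : R) :
  measurable D -> mu D = 1%E -> nu D = 1%E -> 0 < a ->
  (forall l, measurable_fun D (X l)) -> (forall l x, D x -> `|X l x| <= C) ->
  (forall l, (\int[mu]_(x in D) X l x)%R = a) ->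
  (forall k l, (k < l)%N -> (\int[mu]_(x in D) (X k x * X l x))%R = a ^+ 2) ->
  (forall k l, (k < l)%N -> (\int[nu]_(x in D) (X k x * X l x))%R = 0) ->
  exists A, [/\ measurable A, A `<=` D, mu (D `\` A) = 0%E & nu A = 0%E].
Proof.
move=> mD mu1 nu1 a0 mX XC mua mua2 nu0.
pose S n x := \sum_(l < n) X l x.
have mS n : measurable_fun D (S n) by exact: measurable_sum.
pose h j : R := (2 ^ j)%:R * (a / 2).
pose E j := D `&` [set x | h j <= S (2 ^ j)%N x].
have mE j : measurable (E j).
  exact: measurable_superlevel.
have a20 : 0 < a / 2 by rewrite divr_gt0.
have p2 j : (0 < 2 ^ j)%N by rewrite expn_gt0.
have nuE j : (nu (E j) <= (C ^+ 2 / (a / 2) ^+ 2 / (2 ^ j)%:R)%:E)%E.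
  apply: le_trans (chebyshev_sum mD nu1 mX XC nu0 a20 (p2 j)).
  apply: le_measure; rewrite ?inE//; last first.
    by move=> x [Dx /= hx]; split=> //=; exact: le_trans hx (ler_norm _).
  by apply: measurable_superlevel => //; apply: measurableT_comp => //; exact: mS.
pose Y l x := X l x - a.
have mY l : measurable_fun D (Y l) by exact: measurable_funB.
have YC l x : D x -> `|Y l x| <= C + a.
  move=> Dx; apply: le_trans (ler_normB _ _) _.
  by rewrite lerD ?XC// ger0_norm// ltW.
have iX l : mu.-integrable D (EFin \o X l).
  exact: (integrable_of_bounded mD mu1 (mX l) (XC l)).
have muY k l : (k < l)%N -> (\int[mu]_(x in D) (Y k x * Y l x))%R = 0.
  move=> kl; have -> : (\int[mu]_(x in D) (Y k x * Y l x))%R =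
     (\int[mu]_(x in D) ((X k x * X l x - a * X k x) - (a * X l x - cst (a ^+ 2) x)))%R.
    by apply: eq_Rintegral => x _; rewrite /Y /cst; ring.
  have i0 : mu.-integrable D (EFin \o (fun x => X k x * X l x)).
    apply: (@integrable_of_bounded _ _ _ (C * C)) => //; first exact: measurable_funM.
    by move=> x Dx; rewrite normrM ler_pM ?XC.
  have ia n : mu.-integrable D (EFin \o (fun x => a * X n x)).
    apply: (@integrable_of_bounded _ _ _ (a * C)) => //; first exact: measurable_funM.
    by move=> x Dx; rewrite normrM (gtr0_norm a0) ler_wpM2l ?XC// ltW.
  have ic : mu.-integrable D (EFin \o cst (a ^+ 2)).
    by apply: (@integrable_of_bounded _ _ _ (a ^+ 2)) => // x _; rewrite ger0_norm// sqr_ge0.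
  rewrite RintegralB//; [|exact: (integrableB mD i0 (ia k))|exact: (integrableB mD (ia l) ic)].
  have int_cst : (\int[mu]_(x in D) cst (a ^+ 2) x)%R = a ^+ 2.
    by rewrite Rintegral_cst// mu1 mulr1.
  rewrite (RintegralB mD i0 (ia k)) (RintegralB mD (ia l) ic) int_cst mua2//.
  by rewrite !RintegralZl// !mua; ring.
have muE j : (mu (D `\` E j) <= ((C + a) ^+ 2 / (a / 2) ^+ 2 / (2 ^ j)%:R)%:E)%E.
  apply: le_trans (chebyshev_sum mD mu1 mY YC muY a20 (p2 j)).
  apply: le_measure; rewrite ?inE//; first exact: measurableD.
    apply: measurable_superlevel => //; apply: measurableT_comp => //.
    exact: measurable_sum.
  move=> x [Dx nE]; split=> //=.
  have -> : \sum_(l < 2 ^ j) Y l x = S (2 ^ j)%N x - (2 ^ j)%:R * a.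
    by rewrite /Y sumrB sumr_const card_ord mulr_natl.
  have : S (2 ^ j)%N x < h j by rewrite ltNge; apply/negP => hx; apply: nE.
  rewrite /h => lt; rewrite ler0_norm; first lra.
  have : 0 <= (2 ^ j)%:R * (a / 2) by rewrite mulr_ge0// ltW.
  lra.
exists (lim_sup_set E); split.
- by apply: bigcap_measurable => // k _; apply: bigcup_measurable => j _.
- by move=> x /(_ 0%N Logic.I) [j _ []].
- have mDE j : measurable (D `\` E j) by exact: measurableD.
  have c0 : 0 <= (C + a) ^+ 2 / (a / 2) ^+ 2 by rewrite divr_ge0// sqr_ge0.
  have lim0 := lim_sup_set_cvg0 mDE (geometric_measures_summable c0 muE).
  apply/eqP; rewrite eq_le measure_ge0 andbT -lim0.
  apply: le_measure; rewrite ?inE//.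
  + apply: measurableD => //.
    by apply: bigcap_measurable => // k _; apply: bigcup_measurable => j _.
  + by apply: bigcap_measurable => // k _; apply: bigcup_measurable => j _.
  + move=> x [Dx nA] k _; apply: contra_notP nA => nk n _.
    exists (maxn k n); first exact: leq_maxr.
    apply: contra_notP nk => nE; exists (maxn k n); first exact: leq_maxl.
    by split.
- apply: lim_sup_set_cvg0 => //; apply: geometric_measures_summable nuE.
  by rewrite divr_ge0// sqr_ge0.
Qed.

End weak_law.

(** * Walsh polynomials *)

Section walsh_polynomials.
Context (R : realType).
Implicit Types (x y z : dyadic) (c e q : nat -> R).

Definition shift (k : nat) x : dyadic := fun j => x (k + j)%N.

Lemma walsh_prod K n x : (n < 2 ^ K)%N ->
  walsh R n x = \prod_(j < K) rademacher R j x ^+ odd (n %/ 2 ^ j).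
Proof.
have stable a d : (n < 2 ^ a)%N -> \prod_(j < a + d) rademacher R j x ^+ odd (n %/ 2 ^ j) =
    \prod_(j < a) rademacher R j x ^+ odd (n %/ 2 ^ j).
  move=> na; elim: d => [|d IH]; first by rewrite addn0.
  rewrite addnS big_ord_recr/= IH divn_small/= ?expr0 ?mulr1//.
  by apply: leq_trans na _; rewrite leq_exp2l// leq_addr.
move=> nK; have nn : (n < 2 ^ n)%N by exact: ltn_expl.
by rewrite /walsh -[LHS](stable n K nn) -[RHS](stable K n nK) addnC.
Qed.

Lemma walsh0 x : walsh R 0 x = 1.
Proof. by rewrite /walsh big_ord0. Qed.

Lemma norm_rademacher j x : `|rademacher R j x| = 1.
Proof. by rewrite /rademacher normrX normrN normr1 expr1n. Qed.

Lemma norm_walsh n x : `|walsh R n x| = 1.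
Proof.
rewrite /walsh normr_prod big1// => j _.
by rewrite normrX norm_rademacher expr1n.
Qed.

Lemma walsh_block k i j x : (i < 2 ^ k)%N ->
  walsh R (j * 2 ^ k + i) x = walsh R i x * walsh R j (shift k x).
Proof.
move=> ik; rewrite (@walsh_prod (k + j)); last first.
  rewrite expnD; apply: leq_trans (_ : (j.+1 * 2 ^ k <= _)%N).
    by rewrite mulSn addnC ltn_add2r.
  by rewrite mulnC leq_mul2l ltn_expl// orbT.
have jj : (j < 2 ^ j)%N by exact: ltn_expl.
rewrite (walsh_prod x ik) (walsh_prod (shift k x) jj) big_split_ord/=.
congr (_ * _); apply: eq_bigr => a _; congr (_ ^+ nat_of_bool _).
  have ak := ltn_ord a; rewrite -{1}(subnK (ltnW ak)) expnD mulnA divnMDl ?expn_gt0//.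
  by rewrite oddD oddM oddX subn_eq0 leqNgt ak andbF.
by rewrite expnD divnMA divnMDl ?expn_gt0// (divn_small ik) addn0.
Qed.

Definition wsum c N x := \sum_(n < N) c n * walsh R n x.

(** A polynomial in fresh variables, with coefficients [q], times a polynomial
    with coefficients [e] in the first [k] variables; its partial sums are cut
    inside a block of the fresh frequency [j]. *)
Lemma wsum_block k j i c q e x : (i <= 2 ^ k)%N ->
  (forall n, (n < j * 2 ^ k + i)%N -> c n = q (n %/ 2 ^ k)%N * e (n %% 2 ^ k)%N) ->
  wsum c (j * 2 ^ k + i) x =
  wsum q j (shift k x) * wsum e (2 ^ k) x + q j * walsh R j (shift k x) * wsum e i x.
Proof.
move=> ik cE; have k0 : (0 < 2 ^ k)%N by rewrite expn_gt0.
pose h p r := q p * walsh R p (shift k x) * (e r * walsh R r x).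
transitivity (\sum_(n < j * 2 ^ k + i) h (n %/ 2 ^ k)%N (n %% 2 ^ k)%N).
  apply: eq_bigr => n _; rewrite cE//.
  have -> : walsh R n x = walsh R (n %% 2 ^ k) x * walsh R (n %/ 2 ^ k) (shift k x).
    by rewrite {1}(divn_eq n (2 ^ k)) walsh_block ?ltn_mod.
  by rewrite /h; ring.
rewrite sum_blocks// /wsum mulr_suml mulr_sumr; congr (_ + _).
by apply: eq_bigr => p _; rewrite mulr_sumr.
Qed.

Lemma wsum_le c N x (C : R) : (forall n, (n < N)%N -> `|c n| <= C) ->
  `|wsum c N x| <= N%:R * C.
Proof.
move=> cC; apply: le_trans (ler_norm_sum _ _ _) _.
rewrite mulr_natl -[N in leRHS]card_ord -sumr_const; apply: ler_sum => n _.
by rewrite normrM norm_walsh mulr1 cC.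
Qed.

(** ** Flat sign functions *)

(** Walsh coefficients of the sign [(-1) ^ (x && y)], that is of
    [(1 + r_1 + r_2 - r_1 r_2) / 2]. *)
Definition bent_digit (d : nat) : R := if (d < 3)%N then 2^-1 else - 2^-1.

(** Walsh coefficients of the product of [m] such signs in separate pairs of
    variables, a bent function: it takes the values 1 and -1, and all its
    coefficients have the same modulus [2 ^- m]. *)
Fixpoint bent_coef (m v : nat) : R :=
  if m is m'.+1 then bent_digit (v %/ 2 ^ m'.*2) * bent_coef m' (v %% 2 ^ m'.*2)
  else (v == 0)%:R.

Fixpoint bent (m : nat) y : bool :=
  if m is m'.+1 then bent m' y (+) (y m'.*2 && y m'.*2.+1) else false.

Lemma norm_bent_coef m v : `|bent_coef m v| <= 2^-1 ^+ m.
Proof.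
elim: m v => [|m IH] v /=; first by rewrite expr0; case: eqP => _; rewrite ?normr1 ?normr0.
rewrite normrM exprS ler_pM// /bent_digit.
by case: ifP => _; rewrite ?normrN ger0_norm ?invr_ge0.
Qed.

Lemma walsh1 z : walsh R 1 z = rademacher R 0 z.
Proof. by rewrite /walsh !big_ord_recl big_ord0 /= ?expr1 ?expr0 ?mulr1 ?mul1r. Qed.

Lemma walsh2 z : walsh R 2 z = rademacher R 1 z.
Proof. by rewrite /walsh !big_ord_recl big_ord0 /= ?expr1 ?expr0 ?mulr1 ?mul1r. Qed.

Lemma walsh3 z : walsh R 3 z = rademacher R 0 z * rademacher R 1 z.
Proof. by rewrite /walsh !big_ord_recl big_ord0 /= ?expr1 ?expr0 ?mulr1 ?mul1r. Qed.

Lemma wsum_bent_digit z : wsum bent_digit 4 z = (-1) ^+ (z 0%N && z 1%N).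
Proof.
rewrite /wsum !big_ord_recl big_ord0 /= walsh0 walsh1 walsh2 walsh3 /rademacher /bent_digit /=.
by case: (z 0%N); case: (z 1%N); rewrite /= ?expr0 ?expr1; lra.
Qed.

Lemma wsum_bent_digit_le j z : (j < 4)%N -> `|wsum bent_digit j z| <= 3 / 2.
Proof.
move=> j4; apply: le_trans (_ : j%:R * 2^-1 <= _).
  apply: wsum_le => n _; rewrite /bent_digit.
  by case: ifP => _; rewrite ?normrN ger0_norm ?invr_ge0.
by rewrite ler_wpM2r// ler_nat.
Qed.

Lemma wsum_bent m y : wsum (bent_coef m) (2 ^ m.*2) y = (-1) ^+ bent m y.
Proof.
elim: m => [|m IH]; first by rewrite /wsum big_ord1 /= walsh0 mulr1.
have -> : (2 ^ m.+1.*2 = 4 * 2 ^ m.*2 + 0)%N by rewrite doubleS !expnS addn0 mulnA.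
rewrite (@wsum_block _ _ _ _ bent_digit (bent_coef m))//.
rewrite [wsum _ 0 _]big_ord0 mulr0 addr0 IH wsum_bent_digit /= signr_addb mulrC.
by rewrite /shift addn0 addn1.
Qed.

(** Cutting a block costs half of the bound for the previous step, because a
    digit coefficient is a half; the bound [3] is the fixed point. *)
Lemma wsum_bent_le m N y : (N <= 2 ^ m.*2)%N -> `|wsum (bent_coef m) N y| <= 3.
Proof.
elim: m N => [|m IH] N.
  rewrite expn0 leq_eqVlt ltnS leqn0 => /orP[] /eqP ->.
    by rewrite /wsum big_ord1 /= walsh0 mulr1 normr1 ler1n.
  by rewrite [wsum _ 0 _]big_ord0 normr0.
rewrite leq_eqVlt => /predU1P[->|].
  by rewrite wsum_bent normrX normrN1 expr1n ler1n.
rewrite doubleS !expnS mulnA => N4.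
have k0 : (0 < 2 ^ m.*2)%N by rewrite expn_gt0.
have j4 : (N %/ 2 ^ m.*2 < 4)%N by rewrite ltn_divLR.
have iL : (N %% 2 ^ m.*2 <= 2 ^ m.*2)%N by rewrite ltnW// ltn_mod.
rewrite (divn_eq N (2 ^ m.*2)) (@wsum_block _ _ _ _ bent_digit (bent_coef m))//.
rewrite wsum_bent; apply: le_trans (ler_normD _ _) _.
rewrite !normrM norm_walsh mulr1 normrX normrN1 expr1n mulr1.
have := wsum_bent_digit_le (shift m.*2 y) j4; have := IH _ iL.
have -> : `|bent_digit (N %/ 2 ^ m.*2)| = 2^-1.
  by rewrite /bent_digit; case: ifP => _; rewrite ?normrN ger0_norm ?invr_ge0.
move: `|wsum _ _ _| `|wsum _ _ _| => a b; lra.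
Qed.

End walsh_polynomials.

(** * The Walsh-Riesz product *)

Section walsh_riesz_product.
Context (R : realType) (m : nat -> nat -> nat).
Implicit Types (x y z : dyadic).

(** Stage [l] uses the variables of index [walsh_pos l], ...,
    [walsh_pos l + (walsh_scale l).*2]; the last one multiplies the flat
    function of the others. *)
Fixpoint walsh_pos (l : nat) : nat :=
  if l is l'.+1 then (walsh_pos l' + (m l' (2 ^ walsh_pos l')).*2.+1)%N else 0%N.

Definition walsh_scale (l : nat) : nat := m l (2 ^ walsh_pos l).

Lemma walsh_posS l : walsh_pos l.+1 = (walsh_pos l + (walsh_scale l).*2.+1)%N.
Proof. by []. Qed.

Lemma expn_walsh_posS l :
  (2 ^ walsh_pos l.+1 = 2 * 2 ^ (walsh_scale l).*2 * 2 ^ walsh_pos l)%N.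
Proof. by rewrite walsh_posS expnD expnS mulnC. Qed.

Lemma walsh_pos_ge l : (l <= walsh_pos l)%N.
Proof. by elim: l => // l IH; rewrite walsh_posS; lia. Qed.

Lemma walsh_pos_mono k l : (k <= l)%N -> (walsh_pos k <= walsh_pos l)%N.
Proof.
elim: l => [|l IH]; first by rewrite leqn0 => /eqP->.
rewrite leq_eqVlt => /predU1P[->//|/IH/leq_trans]; apply.
by rewrite walsh_posS leq_addr.
Qed.

(** Coefficients of one factor [1 + r b / 4] of the product. *)
Definition walsh_factor (l j : nat) : R :=
  if j == 0%N then 1 else
  if (j < 2 ^ (walsh_scale l).*2)%N then 0 else
  4^-1 * bent_coef R (walsh_scale l) (j - 2 ^ (walsh_scale l).*2).

Lemma wsum_walsh_factor_low l J z : (0 < J <= 2 ^ (walsh_scale l).*2)%N ->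
  wsum (walsh_factor l) J z = 1.
Proof.
case: J => // J /andP[_ JL]; rewrite /wsum big_ord_recl big1 => [|i _].
  by rewrite /walsh_factor /= walsh0 mulr1 addr0.
rewrite /walsh_factor /= /bump /= add1n ifT ?mul0r//.
by apply: leq_trans JL; rewrite ltnS.
Qed.

Lemma wsum_walsh_factor l v z : (v <= 2 ^ (walsh_scale l).*2)%N ->
  wsum (walsh_factor l) (2 ^ (walsh_scale l).*2 + v) z =
  1 + 4^-1 * rademacher R (walsh_scale l).*2 z * wsum (bent_coef R (walsh_scale l)) v z.
Proof.
move=> vL; set L := (2 ^ _)%N; have L0 : (0 < L)%N by rewrite expn_gt0.
rewrite /wsum big_split_ord/=; congr (_ + _).
  by rewrite -[LHS]/(wsum _ L z) wsum_walsh_factor_low// L0 leqnn.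
rewrite mulr_sumr; apply: eq_bigr => i _.
have iL : (i < L)%N by apply: leq_trans vL.
rewrite -{2}[L]mul1n walsh_block// walsh1 /rademacher /shift addn0.
rewrite /walsh_factor ifF ?ifF ?addKn; [ring|by rewrite ltnNge leq_addr|].
by apply/negbTE; rewrite -lt0n ltn_addr.
Qed.

Lemma norm_walsh_factor l j : (0 < j)%N ->
  `|walsh_factor l j| <= 4^-1 * 2^-1 ^+ walsh_scale l.
Proof.
move=> j0; rewrite /walsh_factor gtn_eqF//; case: ifP => _.
  by rewrite normr0 mulr_ge0// exprn_ge0// invr_ge0.
by rewrite normrM ger0_norm// ler_wpM2l// norm_bent_coef.
Qed.

(** The constant 1/4 in the factors is chosen against the bound 3 for the
    partial sums of the bent function. *)
Lemma wsum_walsh_factor_ge l J z : (0 < J <= 2 * 2 ^ (walsh_scale l).*2)%N ->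
  4^-1 <= wsum (walsh_factor l) J z.
Proof.
move=> /andP[J0 JL]; have [JK|KJ] := leqP J (2 ^ (walsh_scale l).*2).
  by rewrite wsum_walsh_factor_low ?J0// invf_le1// ler1n.
rewrite -(subnKC (ltnW KJ)) wsum_walsh_factor; last by rewrite leq_subLR addnn -mul2n.
have := @wsum_bent_le R (walsh_scale l) (J - 2 ^ (walsh_scale l).*2) z.
rewrite leq_subLR addnn -mul2n => /(_ JL); set w := wsum _ _ _.
have : `|rademacher R (walsh_scale l).*2 z * w| = `|w| by rewrite normrM norm_rademacher mul1r.
rewrite -mulrA; move: (rademacher _ _ _ * w) => u uw w3.
have : - u <= 3 by apply: le_trans (ler_norm _) _; rewrite normrN uw.
lra.
Qed.

Section coefficients.
Variable c : nat -> R.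
Hypothesis c0 : c 0%N = 1.
Hypothesis cE : forall l n, (n < 2 ^ walsh_pos l.+1)%N ->
  c n = walsh_factor l (n %/ 2 ^ walsh_pos l) * c (n %% 2 ^ walsh_pos l).

Lemma norm_walsh_riesz_le1 n : `|c n| <= 1.
Proof.
suff H l : forall n, (n < 2 ^ walsh_pos l)%N -> `|c n| <= 1.
  apply: (H n); apply: leq_trans (ltn_expl n (ltnSn 1)) _.
  by rewrite leq_exp2l// walsh_pos_ge.
elim: l {n} => [|l IH] n nl; first by case: n nl => // _; rewrite c0 normr1.
rewrite (cE nl) normrM mulr_ile1// ?IH ?ltn_mod ?expn_gt0//.
case: (posnP (n %/ 2 ^ walsh_pos l)) => [->|n0]; first by rewrite normr1.
apply: le_trans (norm_walsh_factor _ n0) _.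
by rewrite mulr_ile1 ?exprn_ge0 ?exprn_ile1 ?invr_ge0// invf_le1// ler1n.
Qed.

Hypothesis mP : forall l,
  2^-1 ^+ walsh_scale l * (2 ^ walsh_pos l)%:R <= 4^-1 ^+ l :> R.

(** A partial sum is a positive multiple of the previous stage, up to one
    incomplete block whose coefficients are tiny. *)
Lemma walsh_riesz_stage l x :
  (4^-1 ^+ l <= wsum c (2 ^ walsh_pos l) x) /\
  (forall N, (N <= 2 ^ walsh_pos l)%N -> 0 <= wsum c N x).
Proof.
elim: l x => [|l IH] x.
  have w1 : wsum c 1 x = 1 by rewrite /wsum big_ord1 c0 walsh0 mulr1.
  split; first by rewrite expn0 w1 expr0.
  by case=> [|[|//]] _; rewrite ?w1// /wsum big_ord0.
set L := (2 ^ walsh_pos l)%N in IH *.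
have L0 : (0 < L)%N by rewrite expn_gt0.
have [low nonneg] := IH x.
have rec N : (N <= 2 ^ walsh_pos l.+1)%N ->
    wsum c N x = wsum (walsh_factor l) (N %/ L) (shift (walsh_pos l) x) * wsum c L x +
     walsh_factor l (N %/ L) * walsh R (N %/ L) (shift (walsh_pos l) x) * wsum c (N %% L) x.
  move=> NL; rewrite {1}(divn_eq N L); apply: wsum_block; first by rewrite ltnW// ltn_mod.
  by rewrite -divn_eq => n nN; apply: cE; exact: leq_trans nN NL.
split.
  rewrite rec// expn_walsh_posS mulnK// modnMl [wsum c 0 x]big_ord0 mulr0 addr0 exprS.
  apply: ler_pM => //; rewrite ?exprn_ge0 ?invr_ge0//.
  by rewrite wsum_walsh_factor_ge// leqnn muln_gt0 expn_gt0.
move=> N NL; rewrite rec//; have [j0|j0] := posnP (N %/ L).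
  rewrite j0 [wsum _ 0 _]big_ord0 mul0r add0r walsh0 /walsh_factor /= !mul1r.
  by apply: nonneg; rewrite ltnW// ltn_mod.
have jJ : (0 < N %/ L <= 2 * 2 ^ (walsh_scale l).*2)%N.
  rewrite j0 -ltnS ltn_divLR// mulSn -expn_walsh_posS.
  by apply: leq_ltn_trans NL _; rewrite -[X in (X < _)%N]add0n ltn_add2r.
have head := wsum_walsh_factor_ge (shift (walsh_pos l) x) jJ.
have tail : `|walsh_factor l (N %/ L) * walsh R (N %/ L) (shift (walsh_pos l) x) *
    wsum c (N %% L) x| <= 4^-1 * 4^-1 ^+ l.
  rewrite 2!normrM norm_walsh mulr1.
  apply: (@le_trans _ _ (4^-1 * 2^-1 ^+ walsh_scale l * L%:R)); last first.
    by rewrite -mulrA ler_wpM2l// mP.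
  apply: ler_pM => //; first exact: norm_walsh_factor.
  apply: (@le_trans _ _ ((N %% L)%:R * 1)).
    by apply: wsum_le => n _; exact: norm_walsh_riesz_le1.
  by rewrite mulr1 ler_nat ltnW// ltn_mod.
have : 4^-1 * 4^-1 ^+ l <= wsum (walsh_factor l) (N %/ L) (shift (walsh_pos l) x) * wsum c L x.
  by apply: ler_pM => //; rewrite ?exprn_ge0 ?invr_ge0.
move: tail; rewrite ler_norml => /andP[tail _] main.
by rewrite -(subrr (4^-1 * 4^-1 ^+ l)) lerD.
Qed.

Lemma walsh_riesz_pos N x : 0 <= wsum c N x.
Proof.
apply: (walsh_riesz_stage N x).2; apply: leq_trans (ltnW (ltn_expl N (ltnSn 1))) _.
by rewrite leq_exp2l// walsh_pos_ge.
Qed.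

Lemma walsh_riesz_summable (psi : R -> R) :
  {in `[0, +oo[ &, {homo psi : s t / s <= t}} -> (forall t : R, 0 <= t -> 0 <= psi t) ->
  (forall l, psi (2^-1 ^+ walsh_scale l) *
     (2 * 2 ^ walsh_pos l * 4 ^ walsh_scale l)%:R <= 2^-1 ^+ l) ->
  (\sum_(n <oo) (psi `|c n|)%:E < +oo)%E.
Proof.
move=> psi_mono psi0 psiP.
pose u l := \sum_(n < 2 ^ walsh_pos l) psi `|c n|.
have uS l : u l.+1 <= u l + 2^-1 ^+ l.
  have le : (2 ^ walsh_pos l <= 2 ^ walsh_pos l.+1)%N.
    by rewrite leq_exp2l// walsh_posS leq_addr.
  rewrite /u -!(big_mkord xpredT (fun n => psi `|c n|)).
  rewrite (@big_cat_nat _ _ _ (2 ^ walsh_pos l) 0 (2 ^ walsh_pos l.+1))//= lerD2l.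
  apply: le_trans (psiP l).
  have small n : (2 ^ walsh_pos l <= n < 2 ^ walsh_pos l.+1)%N ->
      psi `|c n| <= psi (2^-1 ^+ walsh_scale l).
    move=> /andP[ln nl]; apply: psi_mono.
    - by rewrite in_itv/= normr_ge0.
    - by rewrite in_itv/= exprn_ge0// invr_ge0.
    rewrite (cE nl) normrM -[leRHS]mulr1.
    apply: ler_pM => //; last exact: norm_walsh_riesz_le1.
    apply: le_trans (norm_walsh_factor _ _) _; first by rewrite divn_gt0// expn_gt0.
    by rewrite ler_piMl ?exprn_ge0 ?invr_ge0// invf_le1// ler1n.
  apply: (@le_trans _ _ (\sum_(2 ^ walsh_pos l <= n < 2 ^ walsh_pos l.+1)
      psi (2^-1 ^+ walsh_scale l))); first by rewrite !big_nat; exact: ler_sum.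
  rewrite sumr_const_nat -[leLHS]mulr_natr ler_wpM2l ?psi0 ?exprn_ge0 ?invr_ge0//.
  rewrite ler_nat expn_walsh_posS (_ : 4 ^ walsh_scale l = 2 ^ (walsh_scale l).*2)%N.
    by rewrite mulnAC leq_subr.
  by rewrite -mul2n expnM.
apply: (@bounded_nneseries _ _ (fun l => 2 ^ walsh_pos l)%N (u 0%N + 2)).
- by move=> n; apply: psi0.
- by move=> k; apply: leq_trans (walsh_pos_ge k) (ltnW (ltn_expl _ _)).
- exact: geometric_increments.
Qed.

End coefficients.
End walsh_riesz_product.

(** * Haar measure on the dyadic group *)

Section finitely_many_coordinates.
Implicit Types (x y : dyadic) (K : nat).

Definition agree K x y := forall j, (j < K)%N -> x j = y j.

Lemma agree_le K K' x y : (K <= K')%N -> agree K' x y -> agree K x y.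
Proof. by move=> KK' xy j jK; apply: xy; exact: leq_trans jK KK'. Qed.

Lemma nbhs_agree K (x : cantor_space) : nbhs x [set y | agree K x y].
Proof.
elim: K => [|K IH]; first by apply: filterS filterT => y _ j.
have := @proj_continuous nat (fun=> bool) K x [set x K] (discrete_set1 (x K)).
move=> near_K; apply: filterS (filterI IH near_K) => y [xy /= yK] j.
by rewrite ltnS leq_eqVlt => /predU1P[->|/xy//]; exact/esym.
Qed.

Lemma open_of_agree K (A : set cantor_space) :
  (forall x y, agree K x y -> A x -> A y) -> open A.
Proof.
move=> HA; rewrite openE => x Ax.
by apply: filterS (nbhs_agree K x) => y xy; exact: HA Ax.
Qed.

Lemma measurable_open (A : set dyadic) :
  open (A : set cantor_space) -> measurable A.
Proof. by move=> oA; exact: sub_sigma_algebra. Qed.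

Lemma measurable_of_agree (R : realType) K (f : dyadic -> R) :
  (forall x y, agree K x y -> f x = f y) -> measurable_fun setT f.
Proof.
move=> fK _ Y _; rewrite setTI; apply: measurable_open; apply: (@open_of_agree K) => x y xy /=.
by rewrite (fK x y).
Qed.

Lemma measurable_coordinatewise (K : nat -> nat) (F : dyadic -> dyadic) :
  (forall n x y, agree (K n) x y -> F x n = F y n) -> measurable_fun setT F.
Proof.
move=> FK; have cF : continuous (F : cantor_space -> cantor_space).
  move=> x; apply/cvg_sup => i; move: x; apply: continuous_comp_initial => x A.
  move=> /nbhs_singleton Ax; apply: filterS (nbhs_agree (K i) x) => y xy /=.
  by rewrite /proj /= -(FK _ _ _ xy).
apply: (@measurability _ _ dyadic dyadic setT F (@open cantor_space) erefl).
move=> _ [B oB <-]; rewrite setTI; apply: measurable_open.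
by move/continuousP : cF; apply.
Qed.

End finitely_many_coordinates.

Section haar_integrals.
Context (R : realType) (haar : probability dyadic R).
Hypothesis haarP : is_haar haar.
Implicit Types (x y : dyadic) (f g : dyadic -> R).

(** One bound serves for the coordinates on which the function depends and for
    its size. *)
Definition tame f :=
  exists K : nat, (forall x y, agree K x y -> f x = f y) /\ (forall x, `|f x| <= K%:R).

Lemma tame_measurable f : tame f -> measurable_fun setT f.
Proof. by move=> [K [fK _]]; exact: measurable_of_agree fK. Qed.

Lemma tame_integrable f : tame f -> haar.-integrable setT (EFin \o f).
Proof.
move=> tf; have [K [_ fK]] := tf.
apply: (@integrable_of_bounded _ _ _ _ _ _ K%:R) => //; first exact: probability_setT.
exact: tame_measurable.
Qed.

Lemma tameD f g : tame f -> tame g -> tame (fun x => f x + g x).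
Proof.
move=> [K [fK fb]] [L [gL gb]]; exists (K + L)%N; split=> [x y xy|x].
  by rewrite (fK x y) ?(gL x y)//; apply: agree_le xy; rewrite ?leq_addr ?leq_addl.
by rewrite natrD (le_trans (ler_normD _ _))// lerD.
Qed.

Lemma tameM f g : tame f -> tame g -> tame (fun x => f x * g x).
Proof.
move=> [K [fK fb]] [L [gL gb]]; exists (K + L + K * L)%N; split=> [x y xy|x].
  by rewrite (fK x y) ?(gL x y)//; apply: agree_le xy; rewrite -?addnA ?leq_addr// addnCA leq_addr.
by rewrite normrM (le_trans (ler_pM _ _ (fb x) (gb x)))// -natrM ler_nat leq_addl.
Qed.

Lemma tame_cst (c : R) : tame (fun=> c).
Proof.
exists (Num.bound c); split=> // x; apply: ltW.
by have := archi_boundP (normr_ge0 c); rewrite /Num.bound normr_id.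
Qed.

Lemma tame_sign K (b : dyadic -> bool) :
  (forall x y, agree K x y -> b x = b y) -> tame (fun x => (-1) ^+ b x).
Proof.
move=> bK; exists K.+1; split=> [x y xy|x]; last by rewrite normrX normrN1 expr1n ler1n.
by rewrite (bK x y)//; apply: agree_le xy.
Qed.

Lemma tame_rademacher p : tame (rademacher R p).
Proof. by apply: (@tame_sign p.+1 (fun x => x p)) => x y; apply. Qed.

Lemma tame_sum n (F : nat -> dyadic -> R) :
  (forall i, tame (F i)) -> tame (fun x => \sum_(i < n) F i x).
Proof.
move=> tF; elim: n => [|n IH].
  have -> : (fun x => \sum_(i < 0) F i x) = fun=> 0 by apply/funext => x; rewrite big_ord0.
  exact: tame_cst.
rewrite (_ : (fun x => _) = fun x => \sum_(i < n) F i x + F n x); last first.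
  by apply/funext => x; rewrite big_ord_recr.
exact: tameD.
Qed.

Lemma agree_mul K a x y : agree K x y -> agree K (dyadic_mul a x) (dyadic_mul a y).
Proof. by move=> xy j /xy; rewrite /dyadic_mul => ->. Qed.

Lemma measurable_mul a : measurable_fun setT (dyadic_mul a).
Proof.
apply: (@measurable_coordinatewise (fun n => n.+1)) => n x y xy.
exact: (agree_mul a xy).
Qed.

Lemma int_translate a f : tame f ->
  (\int[haar]_x f (dyadic_mul a x))%R = (\int[haar]_x f x)%R.
Proof.
move=> tf; congr fine.
have tfa : tame (f \o dyadic_mul a).
  have [K [fK fb]] := tf; exists K; split=> x //= y xy.
  by apply: fK; exact: agree_mul.
have <- := @integral_pushforward _ _ dyadic dyadic R (dyadic_mul a) (measurable_mul a)
  haar setT (EFin \o f) _ (tame_integrable tfa) measurableT; last first.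
  by apply/measurable_EFinP; exact: tame_measurable.
by apply: eq_measure_integral => [|m_mul A mA _]; [exact: measurable_mul|exact: haarP].
Qed.

Definition flip (p : nat) : dyadic -> dyadic := dyadic_mul (fun i => i == p).

Lemma flipE p x i : flip p x i = (i == p) (+) x i.
Proof. by []. Qed.

Lemma int_odd p f : tame f -> (forall x, f (flip p x) = - f x) ->
  (\int[haar]_x f x)%R = 0.
Proof.
move=> tf odd_f; have : (\int[haar]_x f x)%R = - (\int[haar]_x f x)%R.
  rewrite -{1}(int_translate (fun i => i == p) tf).
  have -> : (\int[haar]_x f (dyadic_mul (fun i => i == p) x))%R =
     (\int[haar]_x (- 1 * f x))%R.
    by apply: eq_Rintegral => x _; rewrite mulN1r -odd_f.
  by rewrite RintegralZl ?mulN1r//; exact: tame_integrable.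
by move=> /eqP; rewrite -addr_eq0 -mulr2n mulrn_eq0 => /eqP.
Qed.

Lemma rademacher_flip p q x :
  rademacher R p (flip q x) = (if p == q then -1 else 1) * rademacher R p x.
Proof.
by rewrite /rademacher flipE signr_addb; case: eqP; rewrite ?expr1 ?expr0.
Qed.

(** True with probability 3/8 when the three bits are independent and fair, so
    that the sign has mean 1/4. *)
Definition biased (p : nat) x : bool :=
  x (4 * p).+1 && (x (4 * p).+2 || x (4 * p).+3).

Lemma tame_biased p : tame (fun x => (-1) ^+ biased p x).
Proof.
apply: (@tame_sign (4 * p).+4 (biased p)) => x y xy.
by rewrite /biased !xy//; lia.
Qed.

(** Expanding the sign in the characters of its three bits, only the constant
    term 1/4 survives: each other term is odd in one of these bits, on which
    [f] does not depend. *)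
Lemma int_biased p f : tame f ->
  (forall i x, (4 * p < i < (4 * p).+4)%N -> f (flip i x) = f x) ->
  (\int[haar]_x (f x * (-1) ^+ biased p x))%R = 4^-1 * (\int[haar]_x f x)%R.
Proof.
move=> tf finv; set a := (4 * p).+1; set b := (4 * p).+2; set c := (4 * p).+3.
pose A := rademacher R a; pose B := rademacher R b; pose C := rademacher R c.
pose f1 x := A x * ((f x * 4^-1) * (3 - B x - C x - B x * C x)).
pose f2 x := B x * ((f x * 4^-1) * (1 + C x)).
pose f3 x := C x * (f x * 4^-1).
have tA : tame A := tame_rademacher a.
have tB : tame B := tame_rademacher b.
have tC : tame C := tame_rademacher c.
have tN g : tame g -> tame (fun x => - g x).
  by move=> tg; rewrite (_ : (fun x => _) = fun x => -1 * g x);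
    [apply: tameM => //; exact: tame_cst | apply/funext => x; rewrite mulN1r].
have tf4 : tame (fun x => f x * 4^-1) by apply: tameM => //; exact: tame_cst.
have t1 : tame f1.
  apply: tameM => //; apply: tameM => //; apply: tameD; last by apply: tN; exact: tameM.
  apply: tameD; last exact: tN.
  by apply: tameD; [exact: tame_cst|exact: tN].
have t2 : tame f2.
  by apply: tameM => //; apply: tameM => //; apply: tameD => //; exact: tame_cst.
have t3 : tame f3 by exact: tameM.
have fE x : f x * (-1) ^+ biased p x = f x * 4^-1 + (f1 x + (f2 x + f3 x)).
  rewrite /f1 /f2 /f3 /A /B /C /rademacher /biased -/a -/b -/c.
  by case: (x a); case: (x b); case: (x c); rewrite /= ?expr0 ?expr1; lra.
have int1 : (\int[haar]_x f1 x)%R = 0.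
  apply: (@int_odd a) => // x; rewrite /f1 finv; last by rewrite /a; lia.
  rewrite /A /B /C !rademacher_flip eqxx ![_ == a]gtn_eqF ?/a ?/b ?/c//; ring.
have int2 : (\int[haar]_x f2 x)%R = 0.
  apply: (@int_odd b) => // x; rewrite /f2 finv; last by rewrite /b; lia.
  rewrite /B /C !rademacher_flip eqxx ![_ == b]gtn_eqF ?/b ?/c//; ring.
have int3 : (\int[haar]_x f3 x)%R = 0.
  apply: (@int_odd c) => // x; rewrite /f3 finv; last by rewrite /c; lia.
  by rewrite /C !rademacher_flip eqxx; ring.
under eq_Rintegral do rewrite fE.
have i1 := tame_integrable t1; have i2 := tame_integrable t2; have i3 := tame_integrable t3.
have i23 := tame_integrable (tameD t2 t3).
rewrite (RintegralD measurableT (tame_integrable tf4) (tame_integrable (tameD t1 (tameD t2 t3)))).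
rewrite (RintegralD measurableT i1 i23) (RintegralD measurableT i2 i3).
rewrite int1 int2 int3 !addr0 RintegralZr//; last exact: tame_integrable.
by rewrite mulrC.
Qed.

Lemma tame_walsh n : tame (walsh R n).
Proof.
exists n.+1; split=> [x y xy|x]; last by rewrite norm_walsh ler1n.
by apply: eq_bigr => j _; rewrite /rademacher (xy j)// ltnS ltnW.
Qed.

End haar_integrals.

(** * The singular measure on the dyadic group *)

Section walsh_measure.
Context (R : realType) (haar : probability dyadic R) (m : nat -> nat -> nat).
Hypothesis haarP : is_haar haar.
Implicit Types (x y : dyadic).

Local Notation pos := (walsh_pos m).
Local Notation scale := (walsh_scale m).

Definition last_pos (l : nat) : nat := (pos l + (scale l).*2)%N.

Lemma walsh_pos_last l : pos l.+1 = (last_pos l).+1.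
Proof. by rewrite walsh_posS addnS. Qed.

Lemma pos_le_last l : (pos l <= last_pos l)%N.
Proof. exact: leq_addr. Qed.

Lemma last_pos_lt k l : (k < l)%N -> (last_pos k < pos l)%N.
Proof. by move=> kl; rewrite -walsh_pos_last walsh_pos_mono. Qed.

Lemma last_pos_inj : injective last_pos.
Proof.
move=> k l kl; apply/eqP; case: (ltngtP k l) => // /last_pos_lt.
  by rewrite kl ltnNge pos_le_last.
by rewrite -kl ltnNge pos_le_last.
Qed.

(** Coordinates of index divisible by 4 are the fair bits from which the sample
    is built; the others only serve to bias the last bit of each block. *)
Definition fair_bits (l : nat) x : dyadic := fun b => x (4 * (pos l + b))%N.

Definition block_sign (l : nat) x : bool := bent (scale l) (fair_bits l x).

(** Pushing Haar measure forward along this map gives each factor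
    [1 + r b / 4] of the product as a conditional law. *)
Definition riesz_map x : dyadic := fun n =>
  if [pick l : 'I_n.+1 | n == last_pos l] is Some l
  then biased n x (+) block_sign l x else x (4 * n)%N.

Lemma riesz_map_last l x :
  riesz_map x (last_pos l) = biased (last_pos l) x (+) block_sign l x.
Proof.
rewrite /riesz_map; case: pickP => [k /eqP e|none].
  by rewrite -(last_pos_inj e).
have lP : (l < (last_pos l).+1)%N by rewrite ltnS (leq_trans (walsh_pos_ge m l))// pos_le_last.
by have := none (Ordinal lP); rewrite eqxx.
Qed.

Lemma riesz_map_fair n x : (forall l, n != last_pos l) -> riesz_map x n = x (4 * n)%N.
Proof. by move=> nl; rewrite /riesz_map; case: pickP => // k; rewrite (negbTE (nl k)). Qed.

Lemma riesz_map_block l b x : (b < (scale l).*2)%N ->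
  riesz_map x (pos l + b)%N = fair_bits l x b.
Proof.
move=> bl; rewrite riesz_map_fair// => k; apply/eqP => e.
have : (pos l + b < last_pos l)%N by rewrite ltn_add2l.
rewrite e; case: (ltngtP k l) => [kl|lk|->]; last by rewrite ltnn.
- by have := last_pos_lt kl; rewrite -e ltnNge leq_addr.
- move=> /ltn_trans /(_ (last_pos_lt lk)).
  by rewrite ltnNge pos_le_last.
Qed.

Lemma eq_bent k y z : agree k.*2 y z -> bent k y = bent k z.
Proof.
elim: k => //= k IH yz; rewrite IH; last by apply: agree_le yz; rewrite doubleS; lia.
by rewrite !yz// doubleS; lia.
Qed.

Lemma block_sign_agree l x y :
  (forall b, (b < (scale l).*2)%N -> x (4 * (pos l + b))%N = y (4 * (pos l + b))%N) ->
  block_sign l x = block_sign l y.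
Proof. by move=> xy; apply: eq_bent => b /xy. Qed.

Lemma riesz_map_agree n x y : agree (4 * n.+1) x y -> riesz_map x n = riesz_map y n.
Proof.
move=> xy; rewrite /riesz_map; case: pickP => [k /eqP nk|_]; last by apply: xy; lia.
rewrite /biased !xy; try lia; congr (_ (+) _); apply: block_sign_agree => b bk.
by apply: xy; move: nk; rewrite /last_pos; move: (nat_of_ord k) bk => k' bk' ->; lia.
Qed.

Lemma walsh_agree n K x y : (n < 2 ^ K)%N -> agree K x y -> walsh R n x = walsh R n y.
Proof.
move=> nK xy; rewrite !(walsh_prod R _ nK); apply: eq_bigr => j _.
by rewrite /rademacher xy.
Qed.

Lemma tame_comp (F : dyadic -> dyadic) K K' (f : dyadic -> R) :
  (forall x y, agree K' x y -> agree K (F x) (F y)) ->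
  (forall x y, agree K x y -> f x = f y) -> (forall x, `|f x| <= 1) -> tame (f \o F).
Proof.
move=> FK fK f1; exists K'.+1; split=> [x y xy /=|x /=].
  by apply/fK/FK; apply: agree_le xy.
by apply: le_trans (f1 _) _; rewrite ler1n.
Qed.

Lemma tame_walsh_riesz n : tame (fun x => walsh R n (riesz_map x)).
Proof.
apply: (@tame_comp riesz_map n (4 * n.+1)); last by move=> x; rewrite norm_walsh.
- by move=> x y xy j jn; apply: riesz_map_agree; apply: agree_le xy; lia.
- by move=> x y xy; apply: eq_bigr => j _; rewrite /rademacher xy.
Qed.

Lemma tame_walsh_fair l n : tame (fun x => walsh R n (fair_bits l x)).
Proof.
apply: (@tame_comp (fair_bits l) n (4 * (pos l + n))); last by move=> x; rewrite norm_walsh.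
- by move=> x y xy j jn; apply: xy; lia.
- by move=> x y xy; apply: eq_bigr => j _; rewrite /rademacher xy.
Qed.

Definition riesz_coef (n : nat) : R := (\int[haar]_x walsh R n (riesz_map x))%R.

Lemma walsh_flip n K p x : (n < 2 ^ K)%N -> (p < K)%N ->
  walsh R n (flip p x) = (-1) ^+ odd (n %/ 2 ^ p) * walsh R n x.
Proof.
move=> nK pK; rewrite !(walsh_prod R _ nK).
rewrite (bigD1 (Ordinal pK))//= [in RHS](bigD1 (Ordinal pK))//= mulrA; congr (_ * _).
  by rewrite rademacher_flip eqxx exprMn.
apply: eq_bigr => j jp; rewrite rademacher_flip ifF ?mul1r//.
by apply/negbTE; apply: contra jp => /eqP jp; apply/eqP/val_inj.
Qed.

Lemma differing_bit K u v : (u < 2 ^ K)%N -> (v < 2 ^ K)%N -> u != v ->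
  exists2 p, (p < K)%N & odd (u %/ 2 ^ p) != odd (v %/ 2 ^ p).
Proof.
elim: K u v => [|K IH] u v; first by rewrite expn0; case: u => //; case: v.
rewrite expnS => uK vK uv; have [ouv|ouv] := eqVneq (odd u) (odd v); last first.
  by exists 0%N; rewrite // expn0 !divn1.
have half w : (w < 2 * 2 ^ K)%N -> (w./2 < 2 ^ K)%N by rewrite ltn_half_double -mul2n.
have uv2 : u./2 != v./2.
  apply: contra uv => /eqP uv; rewrite -(odd_double_half u) -(odd_double_half v).
  by rewrite ouv uv.
have [p pK pP] := IH _ _ (half u uK) (half v vK) uv2.
by exists p.+1; rewrite ?ltnS// expnS !divnMA !divn2.
Qed.

Section one_stage.
Variable l : nat.
Let s := pos l.
Let K := (scale l).*2.

Lemma fair_bits_flip p x : fair_bits l (flip (4 * (s + p)) x) = flip p (fair_bits l x).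
Proof.
apply/funext => b; rewrite /fair_bits !flipE; congr (_ (+) _).
by rewrite eqn_pmul2l// eqn_add2l.
Qed.

Lemma fair_bits_flip_aux i x : (4 * last_pos l < i < (4 * last_pos l).+4)%N ->
  fair_bits l (flip i x) = fair_bits l x.
Proof.
move=> ip; apply/funext => b; rewrite /fair_bits flipE; case: eqP => // e.
by move: ip; rewrite -e; lia.
Qed.

Lemma walsh_riesz_flip n p x : (n < 2 ^ s)%N -> (4 * s <= p)%N ->
  walsh R n (riesz_map (flip p x)) = walsh R n (riesz_map x).
Proof.
move=> ns sp; apply: (@walsh_agree _ s) => // j js; apply: riesz_map_agree => i i4.
by rewrite flipE; case: eqP => // e; move: i4; rewrite e; lia.
Qed.

(** Distinct characters of the fair bits of a block are orthogonal, even in the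
    presence of a function of the earlier blocks. *)
Lemma fair_orthogonal i u v : (i < 2 ^ s)%N -> (u < 2 ^ K)%N -> (v < 2 ^ K)%N ->
  (\int[haar]_x (walsh R i (riesz_map x) *
     (walsh R v (fair_bits l x) * walsh R u (fair_bits l x))))%R =
  (u == v)%:R * riesz_coef i.
Proof.
move=> is_ uK vK; have [->|uv] := eqVneq u v.
  rewrite mul1r; apply: eq_Rintegral => x _.
  by rewrite -expr2 -[X in _ * X]real_normK ?num_real// norm_walsh expr1n mulr1.
rewrite mul0r; have [p pK pP] := differing_bit uK vK uv.
apply: (int_odd haarP (p := 4 * (s + p))).
  apply: tameM; first exact: tame_walsh_riesz.
  by apply: tameM; exact: tame_walsh_fair.
move=> x; rewrite walsh_riesz_flip//; last by lia.
rewrite fair_bits_flip !(walsh_flip _ _ pK)//.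
by move: pP; case: (odd _); case: (odd _) => //= _; rewrite expr0 expr1; ring.
Qed.

(** A nontrivial frequency of the block that avoids its last variable is a
    character of fair bits, and integrates to 0. The last variable brings the
    mean 1/4 of the bias and the sign of the block; in the Walsh expansion of
    this sign, a single coefficient is not orthogonal to the frequency. *)
Lemma riesz_coef_block n : (n < 2 ^ pos l.+1)%N ->
  riesz_coef n = walsh_factor R m l (n %/ 2 ^ s) * riesz_coef (n %% 2 ^ s).
Proof.
move=> nl; have s0 : (0 < 2 ^ s)%N by rewrite expn_gt0.
set j := (n %/ 2 ^ s)%N; set i := (n %% 2 ^ s)%N.
have is_ : (i < 2 ^ s)%N by rewrite ltn_mod.
have jK : (j < 2 * 2 ^ K)%N by rewrite ltn_divLR// -expn_walsh_posS.
have nE x : walsh R n (riesz_map x) = walsh R i (riesz_map x) * walsh R j (shift s (riesz_map x)).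
  by rewrite {1}(divn_eq n (2 ^ s)) walsh_block.
have low v x : (v < 2 ^ K)%N -> walsh R v (shift s (riesz_map x)) = walsh R v (fair_bits l x).
  by move=> vK; apply: (walsh_agree vK) => b bK; rewrite /shift riesz_map_block.
have [jlow|jhigh] := ltnP j (2 ^ K).
  have -> : walsh_factor R m l j = (j == 0%N)%:R.
    by rewrite /walsh_factor jlow; case: eqP.
  have K0 : (0 < 2 ^ K)%N by rewrite expn_gt0.
  rewrite -(fair_orthogonal is_ jlow K0); apply: eq_Rintegral => x _.
  by rewrite nE low// walsh0 mul1r.
pose v := (j - 2 ^ K)%N.
have vK : (v < 2 ^ K)%N by rewrite ltn_subLR// addnn -mul2n.
have jE : j = (1 * 2 ^ K + v)%N by rewrite mul1n subnKC.
have -> : walsh_factor R m l j = 4^-1 * bent_coef R (scale l) v.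
  rewrite /walsh_factor ltnNge jhigh/= gtn_eqF//.
  by apply: leq_trans jhigh; rewrite expn_gt0.
pose f x := walsh R i (riesz_map x) *
  \sum_(u < 2 ^ K) bent_coef R (scale l) u *
    (walsh R v (fair_bits l x) * walsh R u (fair_bits l x)).
have tf : tame f.
  apply: tameM; first exact: tame_walsh_riesz.
  apply: (@tame_sum _ _ (fun u x => bent_coef R (scale l) u *
    (walsh R v (fair_bits l x) * walsh R u (fair_bits l x)))) => u.
  apply: tameM; first exact: tame_cst.
  by apply: tameM; exact: tame_walsh_fair.
transitivity (\int[haar]_x (f x * (-1) ^+ biased (last_pos l) x))%R.
  apply: eq_Rintegral => x _; rewrite nE jE walsh_block// low// walsh1.
  rewrite /rademacher /shift addn0 -[(s + K)%N]/(last_pos l) riesz_map_last signr_addb.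
  rewrite /block_sign -wsum_bent /f /wsum -mulrA; congr (_ * _).
  rewrite mulrCA [RHS]mulrC mulr_sumr; congr (_ * _).
  by apply: eq_bigr => u _; rewrite mulrCA.
rewrite (int_biased haarP tf); last first.
  move=> p x pP; rewrite /f walsh_riesz_flip ?fair_bits_flip_aux//.
  by have := pos_le_last l; rewrite -/s; lia.
rewrite -mulrA; congr (_ * _).
pose C u := `|bent_coef R (scale l) u|.
pose g u x := walsh R i (riesz_map x) * (bent_coef R (scale l) u *
  (walsh R v (fair_bits l x) * walsh R u (fair_bits l x))).
transitivity (\int[haar]_x \sum_(u < 2 ^ K) g u x)%R.
  by apply: eq_Rintegral => x _; rewrite /f mulr_sumr.
rewrite (@Rintegral_sum_bounded _ _ _ haar setT (2 ^ K) g C) //; last 3 first.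
- exact: probability_setT.
- move=> u; apply: tame_measurable; apply: tameM; first exact: tame_walsh_riesz.
  by apply: tameM; [exact: tame_cst|apply: tameM; exact: tame_walsh_fair].
- by move=> u x _; rewrite /g /C !normrM !norm_walsh !mulr1 mul1r.
rewrite (bigD1 (Ordinal vK))//= big1 ?addr0 => [|u uv].
  transitivity (\int[haar]_x (bent_coef R (scale l) v * (walsh R i (riesz_map x) *
     (walsh R v (fair_bits l x) * walsh R v (fair_bits l x)))))%R.
    by apply: eq_Rintegral => x _; rewrite /g mulrCA.
  rewrite RintegralZl//; first by rewrite fair_orthogonal// eqxx mul1r.
  apply: tame_integrable; apply: tameM; first exact: tame_walsh_riesz.
  by apply: tameM; exact: tame_walsh_fair.
transitivity (\int[haar]_x (bent_coef R (scale l) u * (walsh R i (riesz_map x) *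
   (walsh R v (fair_bits l x) * walsh R u (fair_bits l x)))))%R.
  by apply: eq_Rintegral => x _; rewrite /g mulrCA.
rewrite RintegralZl//.
  rewrite (fair_orthogonal is_ (ltn_ord u) vK).
  by rewrite -val_eqE/= in uv; rewrite (negbTE uv) mul0r mulr0.
apply: tame_integrable; apply: tameM; first exact: tame_walsh_riesz.
by apply: tameM; exact: tame_walsh_fair.
Qed.

End one_stage.

Lemma int_haar_cst (c : R) : (\int[haar]_x cst c x)%R = c.
Proof. by rewrite Rintegral_cst// [X in fine X](@probability_setT _ _ _ haar) mulr1. Qed.

Lemma riesz_coef0 : riesz_coef 0 = 1.
Proof.
rewrite /riesz_coef; under eq_Rintegral do rewrite walsh0.
exact: int_haar_cst.
Qed.

(** ** Singularity *)

Lemma measurable_riesz_map : measurable_fun setT riesz_map.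
Proof.
apply: (@measurable_coordinatewise (fun n => 4 * n.+1)%N) => n x y.
exact: riesz_map_agree.
Qed.

HB.instance Definition _ := isMeasurableFun.Build _ _ dyadic dyadic riesz_map
  measurable_riesz_map.

Definition walsh_riesz_measure : probability dyadic R :=
  distribution haar (riesz_map : {mfun dyadic >-> dyadic}).

Lemma int_walsh_riesz_measure f : tame f -> tame (f \o riesz_map) ->
  (\int[walsh_riesz_measure]_x f x)%R = (\int[haar]_x f (riesz_map x))%R.
Proof.
move=> tf tfm; congr fine.
rewrite (@integral_distribution _ _ dyadic dyadic R haar riesz_map (EFin \o f))//.
  by apply/measurable_EFinP; exact: tame_measurable.
exact: tame_integrable.
Qed.

Lemma walsh_coefE n : walsh_coef walsh_riesz_measure n = riesz_coef n.
Proof.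
by apply: int_walsh_riesz_measure; [exact: tame_walsh|exact: tame_walsh_riesz].
Qed.

(** The sign [r b] of stage [l] has mean 0 for Haar measure and mean 1/4 for
    the new measure, where it depends only on the biasing bits. *)
Definition stage_bit (l : nat) x : bool :=
  x (last_pos l) (+) bent (scale l) (shift (pos l) x).

Lemma stage_bit_agree l x y : agree (pos l.+1) x y -> stage_bit l x = stage_bit l y.
Proof.
rewrite walsh_pos_last => xy; rewrite /stage_bit xy//; congr (_ (+) _).
by apply: eq_bent => b bl; apply: xy; rewrite /last_pos ltnS leq_add2l ltnW.
Qed.

Lemma stage_bit_flip l x : stage_bit l (flip (last_pos l) x) = ~~ stage_bit l x.
Proof.
rewrite /stage_bit flipE eqxx -addbA addTb; congr (~~ (_ (+) _)).
apply: eq_bent => b bl; rewrite /shift flipE /last_pos eqn_add2l.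
by rewrite ltn_eqF.
Qed.

Lemma stage_bit_riesz l x : stage_bit l (riesz_map x) = biased (last_pos l) x.
Proof.
rewrite /stage_bit riesz_map_last -addbA (_ : bent _ _ = block_sign l x) ?addbb ?addbF//.
by apply: eq_bent => b bl; rewrite /shift riesz_map_block.
Qed.

Let X l x : R := (-1) ^+ stage_bit l x.

Let tame_stage l : tame (X l).
Proof. by apply: (@tame_sign R (pos l.+1)) => x y; exact: stage_bit_agree. Qed.

Let tame_stage_riesz l : tame (X l \o riesz_map).
Proof.
rewrite (_ : _ \o _ = fun x => (-1) ^+ biased (last_pos l) x); first exact: tame_biased.
by apply/funext => x; rewrite /X /= stage_bit_riesz.
Qed.

Lemma walsh_riesz_singular : mutually_singular walsh_riesz_measure haar.
Proof.
have [|||||||||A [mA _ muA nuA]] := @weak_law_singular _ dyadic R walsh_riesz_measure haar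
  setT X 4^-1 1.
- exact: measurableT.
- exact: probability_setT.
- exact: probability_setT.
- by [].
- by move=> l; apply: tame_measurable.
- by move=> l x _; rewrite /X normrX normrN1 expr1n.
- move=> l; rewrite int_walsh_riesz_measure//.
  transitivity (\int[haar]_x (cst 1 x * (-1) ^+ biased (last_pos l) x))%R.
    by apply: eq_Rintegral => x _; rewrite mul1r /X stage_bit_riesz.
  rewrite (int_biased haarP)//; last exact: tame_cst.
  by rewrite int_haar_cst mulr1.
- move=> k l kl; rewrite int_walsh_riesz_measure//; last 2 first.
  + exact: tameM.
  + exact: (tameM (tame_stage_riesz k) (tame_stage_riesz l)).
  transitivity (\int[haar]_x ((-1) ^+ biased (last_pos k) x * (-1) ^+ biased (last_pos l) x))%R.
    by apply: eq_Rintegral => x _; rewrite /X !stage_bit_riesz.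
  rewrite (int_biased haarP)//; [|exact: tame_biased|]; last first.
    move=> i x il; have kl' : (last_pos k < last_pos l)%N.
      exact: leq_trans (last_pos_lt kl) (pos_le_last l).
    by rewrite /biased !flipE !ltn_eqF//; lia.
  rewrite expr2; congr (_ * _).
  transitivity (\int[haar]_x (cst 1 x * (-1) ^+ biased (last_pos k) x))%R.
    by apply: eq_Rintegral => x _; rewrite mul1r.
  rewrite (int_biased haarP)//; last exact: tame_cst.
  by rewrite int_haar_cst mulr1.
- move=> k l kl; apply: (int_odd haarP (p := last_pos l)); first exact: tameM.
  move=> x; rewrite /X stage_bit_flip (@stage_bit_agree k _ x).
    by rewrite signrN mulrN.
  move=> j jk; rewrite flipE ltn_eqF// (leq_trans jk)//.
  by rewrite (leq_trans (walsh_pos_mono m kl))// pos_le_last.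
by exists A; rewrite -setTD.
Qed.

End walsh_measure.

Lemma walsh_part (R : realType) (psi : R -> R) (haar : probability dyadic R) :
  {in `[0, +oo[ &, {homo psi : x y / x <= y}} -> (forall t, 0 <= t -> 0 <= psi t) ->
  psi x / x ^+ 2 @[x --> 0^'+] --> (0 : R) -> is_haar haar ->
  exists mu : probability dyadic R,
    [/\ mutually_singular mu haar,
        forall (N : nat) (x : dyadic),
          0 <= \sum_(n < N.+1) walsh_coef mu n * walsh R n x
      & (\sum_(n <oo) (psi `|walsh_coef mu n|)%:E < +oo)%E].
Proof.
move=> psi_mono psi0 /scale_choice [m mP] haarP.
have coefE : walsh_coef (walsh_riesz_measure haar m) = riesz_coef haar m.
  by apply/funext => n; exact: walsh_coefE.
have coef0 := riesz_coef0 haar m.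
have coefB l n : (n < 2 ^ walsh_pos m l.+1)%N -> _ := @riesz_coef_block R haar m haarP l n.
exists (walsh_riesz_measure haar m); rewrite coefE; split.
- exact: walsh_riesz_singular.
- move=> N x; apply: (@walsh_riesz_pos R m (riesz_coef haar m)) => // l.
  by have [] := mP l (2 ^ walsh_pos m l)%N.
- apply: (walsh_riesz_summable coef0 coefB) => // l.
  by have [] := mP l (2 ^ walsh_pos m l)%N.
Qed.

(** * Rudin-Shapiro sums *)

Section rudin_shapiro.
Context (R : realType).
Implicit Types (e : nat -> R) (t phi : R).

Definition trig_sum e N t phi : R := \sum_(v < N) e v * cos (v%:R * t + phi).

Lemma trig_sum_phase e N t phi :
  trig_sum e N t phi = cos phi * trig_sum e N t 0 + sin phi * trig_sum e N t (pi / 2).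
Proof.
rewrite /trig_sum !mulr_sumr -big_split/=; apply: eq_bigr => v _.
by rewrite addr0 cosDpihalf cosD; ring.
Qed.

Lemma trig_sum_cat e N i t phi :
  trig_sum e (N + i) t phi =
  trig_sum e N t phi + trig_sum (fun v => e (N + v)%N) i t (N%:R * t + phi).
Proof.
rewrite /trig_sum big_split_ord/=; congr (_ + _); apply: eq_bigr => v _.
by rewrite natrD mulrDl addrA [v%:R * t + _]addrC.
Qed.

(** The two Rudin-Shapiro sign sequences of length [2 ^ n], obtained from
    [P, Q] by concatenating [P, Q] and [P, -Q]. *)
Fixpoint shapiro (b : bool) (n v : nat) : R :=
  if n is n'.+1 then
    if (v < 2 ^ n')%N then shapiro false n' v
    else (-1) ^+ b * shapiro true n' (v - 2 ^ n')
  else 1.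

Lemma norm_shapiro b n v : `|shapiro b n v| = 1.
Proof.
elim: n b v => [|n IH] b v /=; first exact: normr1.
by case: ifP => _; rewrite ?normrM ?normrX ?normrN1 ?expr1n ?mul1r IH.
Qed.

Lemma shapiro_low b n N t phi : (N <= 2 ^ n)%N ->
  trig_sum (shapiro b n.+1) N t phi = trig_sum (shapiro false n) N t phi.
Proof.
move=> Nn; apply: eq_bigr => v _ /=.
by rewrite (leq_trans (ltn_ord v) Nn).
Qed.

Lemma shapiro_high b n i t phi :
  trig_sum (shapiro b n.+1) (2 ^ n + i) t phi =
  trig_sum (shapiro false n) (2 ^ n) t phi +
  (-1) ^+ b * trig_sum (shapiro true n) i t ((2 ^ n)%:R * t + phi).
Proof.
rewrite trig_sum_cat shapiro_low//; congr (_ + _).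
rewrite /trig_sum mulr_sumr; apply: eq_bigr => v _ /=.
by rewrite ltnNge leq_addr/= addKn mulrA.
Qed.

Let energy b n t :=
  trig_sum (shapiro b n) (2 ^ n) t 0 ^+ 2 + trig_sum (shapiro b n) (2 ^ n) t (pi / 2) ^+ 2.

(** The parallelogram identity, iterated; the two phases are the real and
    imaginary parts of the exponential sums. *)
Lemma shapiro_energy n t : energy false n t + energy true n t = 2 ^+ n.+1.
Proof.
elim: n => [|n IH].
  rewrite /energy /trig_sum !big_ord1/= !mul0r !add0r !mul1r cos0 cos_pihalf expr1.
  by rewrite expr1n expr0n/=; lra.
rewrite exprS -IH /energy expnS mul2n -addnn !shapiro_high !addr0.
rewrite ![trig_sum _ _ _ (_ * t)]trig_sum_phase ![trig_sum _ _ _ (_ * t + _)]trig_sum_phase.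
rewrite cosDpihalf sinDpihalf expr0 expr1.
have := cos2Dsin2 ((2 ^ n)%:R * t).
move: (cos _) (sin _) (trig_sum _ _ _ _) (trig_sum _ _ _ _) (trig_sum _ _ _ _) (trig_sum _ _ _ _).
move=> c s p' q' q p cs.
rewrite [LHS](_ : _ = 2 * (p ^+ 2 + p' ^+ 2 + (c ^+ 2 + s ^+ 2) * (q ^+ 2 + q' ^+ 2))); last by ring.
by rewrite cs; ring.
Qed.

Let u : R := Num.sqrt 2.

Let u2 : u ^+ 2 = 2.
Proof. by rewrite sqr_sqrtr. Qed.

Let u0 : 0 <= u.
Proof. exact: sqrtr_ge0. Qed.

Lemma shapiro_full_le b n t phi : `|trig_sum (shapiro b n) (2 ^ n) t phi| <= u ^+ n.+1.
Proof.
rewrite -(@ler_pXn2r _ 2) ?nnegrE ?exprn_ge0// real_normK ?num_real//.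
rewrite -exprM mulnC exprM u2 -(shapiro_energy n t) trig_sum_phase.
apply: le_trans (_ : energy b n t <= _); last first.
  have ge0 b' : 0 <= energy b' n t by rewrite addr_ge0// sqr_ge0.
  by case: b; rewrite ?lerDl ?lerDr ge0.
rewrite /energy; have := cos2Dsin2 phi.
move: (cos _) (sin _) (trig_sum _ _ _ _) (trig_sum _ _ _ _) => c s p q cs.
rewrite -subr_ge0 (_ : _ - _ = (s * q - c * p) ^+ 2 + (1 - (c ^+ 2 + s ^+ 2)) * (p ^+ 2 + q ^+ 2)).
  by rewrite cs subrr mul0r addr0 sqr_ge0.
by ring.
Qed.

(** A partial sum in the second half is a full sum of the previous order plus a
    shorter partial sum; the bound survives because [sqrt 2 + 5 <= 5 sqrt 2]. *)
Lemma shapiro_partial_le b n N t phi : (N <= 2 ^ n)%N ->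
  `|trig_sum (shapiro b n) N t phi| <= 5 * u ^+ n.
Proof.
elim: n b N phi => [|n IH] b N phi.
  rewrite expn0 expr0 mulr1 => N1; apply: le_trans (ler_norm_sum _ _ _) _.
  apply: (@le_trans _ _ (\sum_(v < N) 1)).
    by apply: ler_sum => v _; rewrite normrM norm_shapiro mul1r ler_norml cos_geN1 cos_le1.
  by rewrite sumr_const card_ord -[leRHS]/(5%:R) ler_nat (leq_trans N1).
have u1 : 5 <= 4 * u by move: u2 u0; rewrite expr2; nra.
have un : 0 <= u ^+ n by exact: exprn_ge0.
have [Nn _|nN] := leqP N (2 ^ n).
  rewrite shapiro_low//; apply: le_trans (IH _ _ _ Nn) _.
  by rewrite ler_wpM2l// exprS; move: u1 un; nra.
rewrite -(subnKC (ltnW nN)) expnS mul2n -addnn leq_add2l => iN.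
rewrite shapiro_high; apply: le_trans (ler_normD _ _) _.
rewrite normrM normrX normrN1 expr1n mul1r.
have := IH true _ ((2 ^ n)%:R * t + phi) iN; have := shapiro_full_le false n t phi.
rewrite !exprS; move: `|trig_sum _ _ _ _| `|trig_sum _ _ _ _| => x y; move: u1 un; nra.
Qed.

Lemma shapiro_le m N t phi : (N <= 4 ^ m)%N ->
  `|trig_sum (shapiro false m.*2) N t phi| <= 5 * 2 ^+ m.
Proof.
move=> Nm; have -> : 2 ^+ m = u ^+ m.*2 :> R by rewrite -mul2n exprM u2.
by apply: shapiro_partial_le; rewrite -mul2n expnM.
Qed.

End rudin_shapiro.

(** * The trigonometric Riesz product *)

Section cosine_polynomials.
Context (R : realType).
Implicit Types (a : nat -> R) (t phi : R).

Definition dist (i j : nat) : nat := ((i - j) + (j - i))%N.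

(** The index [i] stands for the frequency [i - D]. *)
Definition sym_sum a D t phi : R :=
  \sum_(i < D.*2.+1) a (dist i D) * cos ((i%:R - D%:R) * t + phi).

(** The coefficients are even in the frequency, so the sine parts of opposite
    frequencies cancel. *)
Lemma sym_sum_phase a D t phi : sym_sum a D t phi = cos phi * sym_sum a D t 0.
Proof.
suff H psi : sym_sum a D t psi + sym_sum a D t psi = 2 * (cos psi * sym_sum a D t 0).
  by apply/(mulfI (_ : 2 != 0 :> R)); rewrite ?pnatr_eq0// -H mulr_natl mulr2n.
rewrite {2}/sym_sum (reindex_inj rev_ord_inj)/= -big_split/= !mulr_sumr.
apply: eq_bigr => i _; have : (i <= D.*2)%N by rewrite -ltnS.
move: (nat_of_ord i) => {}i iD.
have -> : dist (D.*2.+1 - i.+1) D = dist i D by rewrite /dist; lia.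
rewrite subSS natrB// -addnn natrD.
have -> : (D%:R + D%:R - i%:R - D%:R) * t + psi = - ((i%:R - D%:R) * t - psi) by ring.
by rewrite cosN addr0 cosB cosD; ring.
Qed.

Lemma centered_sumS a (G : R -> R) D : (forall z, G (- z) = G z) ->
  \sum_(i < D.+1.*2.+1) a (dist i D.+1) * G (i%:R - D.+1%:R) =
  \sum_(i < D.*2.+1) a (dist i D) * G (i%:R - D%:R) + 2 * a D.+1 * G D.+1%:R.
Proof.
move=> GN; rewrite doubleS big_ord_recl big_ord_recr/=.
have -> : dist 0 D.+1 = D.+1 by rewrite /dist; lia.
have -> : dist (bump 0 D.*2.+1) D.+1 = D.+1 by rewrite /dist /bump; lia.
have -> : (bump 0 D.*2.+1)%:R - D.+1%:R = D.+1%:R :> R.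
  have -> : bump 0 D.*2.+1 = (D.+1 + D.+1)%N by rewrite /bump; lia.
  by rewrite natrD addrK.
rewrite sub0r GN (eq_bigr (fun i : 'I_D.*2.+1 => a (dist i D) * G (i%:R - D%:R))).
  by ring.
move=> i _; rewrite /bump /= add1n /dist !subSS -!natr1; congr (_ * G _).
by ring.
Qed.

Lemma centered_sum_add a (G : R -> R) D w : (forall z, G (- z) = G z) ->
  \sum_(i < (D + w).*2.+1) a (dist i (D + w)) * G (i%:R - (D + w)%:R) =
  \sum_(i < D.*2.+1) a (dist i D) * G (i%:R - D%:R) +
  \sum_(u < w) 2 * a (D.+1 + u)%N * G (D.+1 + u)%:R.
Proof.
move=> GN; elim: w => [|w IH]; first by rewrite addn0 big_ord0 addr0.
by rewrite addnS centered_sumS// IH [\sum_(u < w.+1) _]big_ord_recr/= addrA addSn.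
Qed.

Lemma sym_sum0 a t : sym_sum a 0 t 0 = a 0%N.
Proof. by rewrite /sym_sum big_ord1/= /dist subrr mul0r addr0 cos0 mulr1. Qed.

Lemma sym_sum_add a D w t :
  sym_sum a (D + w) t 0 =
  sym_sum a D t 0 + \sum_(u < w) 2 * a (D.+1 + u)%N * cos ((D.+1 + u)%:R * t).
Proof.
have := @centered_sum_add a (fun z => cos (z * t + 0)) D w.
rewrite /sym_sum => ->; last by move=> z; rewrite !addr0 mulNr cosN.
by congr (_ + _); apply: eq_bigr => u _; rewrite addr0.
Qed.

End cosine_polynomials.

Section trig_riesz_product.
Context (R : realType) (m : nat -> nat -> nat).
Implicit Types (t phi : R).

(** Degree after [k] stages: stage [k] uses the multiples [p * (2 D + 1)] with
    [4 ^ m < p <= 2 * 4 ^ m] as frequencies of its new factor, each one smeared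
    over an interval of [2 D + 1] frequencies by the previous product. *)
Fixpoint trig_deg (k : nat) : nat :=
  if k is k'.+1 then
    (trig_deg k' + 2 * 4 ^ m k' (trig_deg k').*2.+1 * (trig_deg k').*2.+1)%N
  else 0%N.

Definition trig_len (k : nat) : nat := (trig_deg k).*2.+1.
Definition trig_scale (k : nat) : nat := m k (trig_len k).

Lemma trig_degS k :
  trig_deg k.+1 = (trig_deg k + 2 * 4 ^ trig_scale k * trig_len k)%N.
Proof. by []. Qed.

Lemma trig_deg_ge k : (k <= trig_deg k)%N.
Proof.
elim: k => // k IH; rewrite trig_degS -addn1 leq_add//.
by rewrite !muln_gt0 expn_gt0.
Qed.

Lemma trig_deg_mono k l : (k <= l)%N -> (trig_deg k <= trig_deg l)%N.
Proof.
elim: l => [|l IH]; first by rewrite leqn0 => /eqP->.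
rewrite leq_eqVlt => /predU1P[->//|/IH/leq_trans]; apply.
by rewrite trig_degS leq_addr.
Qed.

(** Half of the cosine coefficients of one factor of the product. *)
Definition trig_factor (k p : nat) : R :=
  if (p < 4 ^ trig_scale k)%N then 0 else
  16^-1 * 2^-1 ^+ trig_scale k * shapiro R false (trig_scale k).*2 (p - 4 ^ trig_scale k).

Fixpoint trig_coef_at (k n : nat) : R :=
  if k is k'.+1 then
    if (n <= trig_deg k')%N then trig_coef_at k' n else
    let u := (n - (trig_deg k').+1)%N in
    trig_factor k' (u %/ trig_len k') *
      trig_coef_at k' (dist (u %% trig_len k') (trig_deg k'))
  else (n == 0%N)%:R.

Definition trig_coef (n : nat) : R := trig_coef_at n n.

Lemma trig_coef_stable k n : (n <= trig_deg k)%N -> trig_coef_at k n = trig_coef n.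
Proof.
have step l j : (n <= trig_deg l)%N -> trig_coef_at (l + j) n = trig_coef_at l n.
  move=> nl; elim: j => [|j IH]; first by rewrite addn0.
  by rewrite addnS /= (leq_trans nl) ?trig_deg_mono ?leq_addr.
move=> nk; rewrite /trig_coef -(step k n nk).
by rewrite addnC step// trig_deg_ge.
Qed.

Lemma trig_coef0 : trig_coef 0 = 1.
Proof. by []. Qed.

Lemma dist_le i D : (i < D.*2.+1)%N -> (dist i D <= D)%N.
Proof. by rewrite /dist; lia. Qed.

Lemma trig_coef_block k u : (u < 2 * 4 ^ trig_scale k * trig_len k)%N ->
  trig_coef ((trig_deg k).+1 + u)%N = trig_factor k (u %/ trig_len k) *
    trig_coef (dist (u %% trig_len k) (trig_deg k)).
Proof.
move=> uk; rewrite -(@trig_coef_stable k.+1); last by rewrite trig_degS; lia.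
rewrite /= leqNgt ltn_addr// addKn; congr (_ * _); apply: trig_coef_stable.
by apply: dist_le; rewrite ltn_mod.
Qed.

Lemma norm_trig_factor k p : `|trig_factor k p| <= 16^-1 * 2^-1 ^+ trig_scale k.
Proof.
rewrite /trig_factor; case: ifP => _.
  by rewrite normr0 mulr_ge0// exprn_ge0// invr_ge0.
by rewrite normrM norm_shapiro mulr1 ger0_norm// mulr_ge0// exprn_ge0// invr_ge0.
Qed.

(** Every frequency beyond the constant belongs to exactly one stage. *)
Lemma trig_stage_ind (P : nat -> Prop) : P 0%N ->
  (forall k u, (forall n, (n <= trig_deg k)%N -> P n) ->
     (u < 2 * 4 ^ trig_scale k * trig_len k)%N -> P ((trig_deg k).+1 + u)%N) ->
  forall n, P n.
Proof.
move=> P0 PS n; suff H k : forall n, (n <= trig_deg k)%N -> P n by exact: (H n n (trig_deg_ge n)).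
elim: k {n} => [|k IH] n; first by rewrite leqn0 => /eqP->.
have [nk _|kn] := leqP n (trig_deg k); first exact: IH.
by rewrite -(subnKC kn) trig_degS => nk; apply: PS => //; lia.
Qed.

Lemma norm_trig_coef_le1 n : `|trig_coef n| <= 1.
Proof.
elim/trig_stage_ind: n => [|k u IH uk]; first by rewrite trig_coef0 normr1.
rewrite trig_coef_block// normrM mulr_ile1 ?IH ?dist_le ?ltn_mod//.
apply: le_trans (norm_trig_factor _ _) _.
by rewrite mulr_ile1 ?exprn_ge0 ?exprn_ile1 ?invr_ge0// invf_le1// ler1n.
Qed.

Lemma norm_trig_coef_block k u : (u < 2 * 4 ^ trig_scale k * trig_len k)%N ->
  `|trig_coef ((trig_deg k).+1 + u)| <= 16^-1 * 2^-1 ^+ trig_scale k.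
Proof.
move=> uk; rewrite trig_coef_block// normrM -[leRHS]mulr1.
by apply: ler_pM => //; [exact: norm_trig_factor|exact: norm_trig_coef_le1].
Qed.

Definition trig_density k t : R := sym_sum trig_coef (trig_deg k) t 0.

(** The Rudin-Shapiro partial sums are at most [5 * 2 ^ m], and the cosine
    coefficients have size [2 ^- m / 8]. *)
Lemma trig_factor_sum_ge k j t : (j <= 2 * 4 ^ trig_scale k)%N ->
  - (5 / 8) <= \sum_(p < j) 2 * trig_factor k p * cos (p.+1%:R * t).
Proof.
set M := (4 ^ _)%N => jM; have [jlow|jhigh] := leqP j M.
  rewrite big1 ?oppr_le0 ?divr_ge0// => p _.
  by rewrite /trig_factor (leq_trans (ltn_ord p) jlow) mulr0 mul0r.
rewrite -(subnKC (ltnW jhigh)) big_split_ord/= big1 ?add0r => [|p _]; last first.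
  by rewrite /trig_factor ltn_ord mulr0 mul0r.
have small : (j - M <= M)%N by rewrite leq_subLR addnn -mul2n.
have := shapiro_le t (M.+1%:R * t) small.
have -> : \sum_(i < j - M) 2 * trig_factor k (M + i)%N * cos ((M + i).+1%:R * t) =
   8^-1 * 2^-1 ^+ trig_scale k *
   trig_sum (shapiro R false (trig_scale k).*2) (j - M) t (M.+1%:R * t).
  rewrite /trig_sum mulr_sumr; apply: eq_bigr => i _.
  have -> : (M + i).+1%:R * t = i%:R * t + M.+1%:R * t by rewrite -addSn natrD; ring.
  rewrite /trig_factor -/M ltnNge leq_addr/= addKn.
  by field.
rewrite ler_norml => /andP[+ _]; set s := trig_sum _ _ _ _ => le.
have k0 : 0 <= 2^-1 ^+ trig_scale k :> R by rewrite exprn_ge0// invr_ge0.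
have kk : 2^-1 ^+ trig_scale k * 2 ^+ trig_scale k = 1 :> R.
  by rewrite -exprMn mulVf ?expr1n// pnatr_eq0.
apply: (@le_trans _ _ (8^-1 * 2^-1 ^+ trig_scale k * - (5 * 2 ^+ trig_scale k))).
  by rewrite mulrN mulrACA [5 * _]mulrC -mulrA [_ * 5]mulrC mulrCA; nra.
by rewrite ler_wpM2l// mulr_ge0.
Qed.

(** A partial sum is the previous density times a partial sum of the new
    factor, plus one incomplete block of frequencies. *)
Lemma trig_partial_block k w t : (w <= 2 * 4 ^ trig_scale k * trig_len k)%N ->
  sym_sum trig_coef (trig_deg k + w) t 0 =
  trig_density k t *
    (1 + \sum_(p < w %/ trig_len k) 2 * trig_factor k p * cos (p.+1%:R * ((trig_len k)%:R * t))) +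
  \sum_(r < w %% trig_len k) 2 * trig_factor k (w %/ trig_len k) *
    trig_coef (dist r (trig_deg k)) *
    cos ((r%:R - (trig_deg k)%:R) * t + (w %/ trig_len k).+1%:R * ((trig_len k)%:R * t)).
Proof.
move=> wk; set L := trig_len k; set D := trig_deg k.
have L0 : (0 < L)%N by [].
rewrite sym_sum_add mulrDr mulr1 -addrA; congr (_ + _).
pose h p r := 2 * trig_factor k p * trig_coef (dist r D) *
   cos ((r%:R - D%:R) * t + p.+1%:R * (L%:R * t)).
transitivity (\sum_(u < w) h (u %/ L)%N (u %% L)%N).
  apply: eq_bigr => u _; rewrite trig_coef_block; last exact: leq_trans (ltn_ord u) wk.
  rewrite /h mulrA; congr (_ * cos _).
  rewrite {1}(divn_eq u L) (_ : (D.+1 + _)%:R = (u %% L)%:R - D%:R + (u %/ L).+1%:R * L%:R :> R).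
    by ring.
  by rewrite !natrD -!natr1 natrM /L /trig_len -/D -addnn -addn1 !natrD; ring.
have := sum_blocks (w %/ L) h L0 (ltnW (ltn_pmod w L0)); rewrite -divn_eq => ->.
congr (_ + _).
rewrite mulr_sumr; apply: eq_bigr => p _.
rewrite /h; under eq_bigr do rewrite -mulrA.
rewrite -mulr_sumr -/(sym_sum trig_coef D t (p.+1%:R * (L%:R * t))) sym_sum_phase.
by rewrite /trig_density; ring.
Qed.

Hypothesis mP : forall k, 2^-1 ^+ trig_scale k * (trig_len k)%:R <= 4^-1 ^+ k :> R.

(** The complete blocks keep a proportion 3/8 of the previous density and the
    incomplete one costs at most 1/8 of its lower bound. *)
Lemma trig_stage k w t : 4^-1 ^+ k <= trig_density k t ->
  (w <= 2 * 4 ^ trig_scale k * trig_len k)%N ->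
  4^-1 ^+ k.+1 <= sym_sum trig_coef (trig_deg k + w) t 0.
Proof.
move=> low wk; rewrite trig_partial_block//.
have jM : (w %/ trig_len k <= 2 * 4 ^ trig_scale k)%N.
  rewrite -ltnS ltn_divLR// mulSn; apply: leq_ltn_trans wk _.
  by rewrite -[X in (X < _)%N]add0n ltn_add2r.
have := trig_factor_sum_ge ((trig_len k)%:R * t) jM; set A := \sum_(p < _) _ => lowA.
set B := \sum_(r < _) _; have Bs : `|B| <= 8^-1 * 4^-1 ^+ k.
  apply: le_trans (ler_norm_sum _ _ _) _.
  apply: (@le_trans _ _ (\sum_(r < w %% trig_len k) 8^-1 * 2^-1 ^+ trig_scale k)).
    apply: ler_sum => r _; rewrite !normrM (@ger0_norm _ 2)//.
    apply: (@le_trans _ _ (2 * (16^-1 * 2^-1 ^+ trig_scale k) * 1 * 1)); last first.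
      by move: (2^-1 ^+ _) => e; lra.
    apply: ler_pM => //; last by rewrite ler_norml cos_geN1 cos_le1.
    apply: ler_pM => //; last exact: norm_trig_coef_le1.
    by rewrite ler_pM2l// norm_trig_factor.
  rewrite sumr_const card_ord -[leLHS]mulr_natr -mulrA ler_wpM2l//.
  apply: le_trans (mP k); rewrite ler_wpM2l ?exprn_ge0 ?invr_ge0//.
  by rewrite ler_nat ltnW// ltn_mod.
have q0 : 0 <= 4^-1 ^+ k :> R by rewrite exprn_ge0// invr_ge0.
move: Bs; rewrite ler_norml => /andP[Bs _]; rewrite exprS.
move: (4^-1 ^+ k) q0 low Bs lowA => q q0 low Bs lowA.
have : q * (3 / 8) <= trig_density k t * (1 + A) by apply: ler_pM => //; lra.
lra.
Qed.

Lemma trig_density_ge k t : 4^-1 ^+ k <= trig_density k t.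
Proof.
elim: k t => [|k IH] t; first by rewrite /trig_density sym_sum0 trig_coef0.
by rewrite /trig_density trig_degS; exact: trig_stage.
Qed.

Lemma trig_partial_pos N t : 0 <= sym_sum trig_coef N t 0.
Proof.
elim/trig_stage_ind: N => [|k u _ uk]; first by rewrite sym_sum0 trig_coef0.
rewrite addSnnS; apply: le_trans (trig_stage (trig_density_ge k t) uk).
by rewrite exprn_ge0// invr_ge0.
Qed.

Lemma trig_coef_summable (psi : R -> R) :
  {in `[0, +oo[ &, {homo psi : s t / s <= t}} -> (forall t : R, 0 <= t -> 0 <= psi t) ->
  (forall k, psi (2^-1 ^+ trig_scale k) *
     (2 * trig_len k * 4 ^ trig_scale k)%:R <= 2^-1 ^+ k) ->
  (\sum_(n <oo) (psi `|trig_coef n|)%:E < +oo)%E.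
Proof.
move=> psi_mono psi0 psiP.
pose u k := \sum_(n < (trig_deg k).+1) psi `|trig_coef n|.
have uS k : u k.+1 <= u k + 2^-1 ^+ k.
  rewrite /u trig_degS -addSn big_split_ord/= lerD2l.
  apply: le_trans (psiP k).
  apply: (@le_trans _ _ (\sum_(v < 2 * 4 ^ trig_scale k * trig_len k) psi (2^-1 ^+ trig_scale k))).
    apply: ler_sum => v _; apply: psi_mono.
    - by rewrite in_itv/= normr_ge0.
    - by rewrite in_itv/= exprn_ge0// invr_ge0.
    apply: le_trans (norm_trig_coef_block (ltn_ord v)) _.
    by rewrite ler_piMl ?exprn_ge0 ?invr_ge0// invf_le1// ler1n.
  by rewrite sumr_const card_ord -[leLHS]mulr_natr mulnAC.
apply: (@bounded_nneseries _ _ (fun k => (trig_deg k).+1) (u 0%N + 2)).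
- by move=> n; apply: psi0.
- by move=> k; rewrite ltnW// ltnS trig_deg_ge.
- exact: geometric_increments.
Qed.

End trig_riesz_product.

(** * Riemann-Stieltjes integrals of cosines *)

Section stieltjes_comparison.
Context (R : realType).
Implicit Types (x y t phi w : R).

Lemma mvt_le (f df : R -> R) x y : (forall t, is_derive t 1 f (df t)) -> x <= y ->
  exists c, [/\ x <= c, c <= y & f y - f x = df c * (y - x)].
Proof.
move=> fdf xy; have [|c] := MVT_segment xy (fun t _ => fdf t).
  by apply: derivable_within_continuous => t _; exact: ex_derive.
by rewrite in_itv/= => /andP[xc cy] E; exists c.
Qed.

Lemma cos_lipschitz x y : `|cos y - cos x| <= `|y - x|.
Proof.
wlog xy : x y / x <= y.
  move=> H; have [/H//|/ltW/H] := leP x y.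
  by rewrite distrC [leRHS]distrC.
have [c [_ _ ->]] := mvt_le (@is_derive_cos R) xy.
by rewrite normrM ler_piMl// normrN sin_max.
Qed.

(** [H] is, up to a second order error, an indefinite integral of [g dF]. *)
Definition stieltjes_primitive (g : R -> R) (L : R) (F H : R -> R) :=
  forall x y, 0 <= x -> x <= y -> y <= 1 ->
    `|H y - H x - g x * (F y - F x)| <= L * (y - x) * (F y - F x).

Lemma riemann_sum_error g L F H N : stieltjes_primitive g L F H -> (0 < N)%N ->
  F 1 - F 0 = 1 ->
  `|H 1 - H 0 - \sum_(j < N) g (j%:R / N%:R) * (F (j.+1%:R / N%:R) - F (j%:R / N%:R))|
  <= L / N%:R.
Proof.
move=> HF N0 F1; pose X j : R := j%:R / N%:R.
have N0' : 0 < N%:R :> R by rewrite ltr0n.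
have tele (G : R -> R) : G 1 - G 0 = \sum_(j < N) (G (X j.+1) - G (X j)).
  rewrite -(big_mkord xpredT (fun j => G (X j.+1) - G (X j))).
  rewrite (telescope_sumr (fun j => G (X j)))// /X divff ?gt_eqF//.
  by rewrite mul0r.
rewrite tele -sumrB; apply: le_trans (ler_norm_sum _ _ _) _.
apply: (@le_trans _ _ (\sum_(j < N) L / N%:R * (F (X j.+1) - F (X j)))); last first.
  by rewrite -mulr_sumr -tele F1 mulr1.
apply: ler_sum => j _; apply: le_trans (HF _ _ _ _ _) _.
- by rewrite divr_ge0.
- by rewrite ler_pM2r ?invr_gt0// ler_nat.
- by rewrite ler_pdivrMr// mul1r ler_nat.
by rewrite -mulrBl -natrB// subSnn mul1r.
Qed.

(** For a fixed number [N] of points, the Riemann sums of [g dF_ k] converge to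
    that of [g dF], and each integral is within [L / N] of its Riemann sum. *)
Lemma stieltjes_limit g L (F : R -> R) (F_ : nat -> R -> R) H (H_ : nat -> R -> R) (c : R) k0 :
  stieltjes_primitive g L F H -> (forall k, stieltjes_primitive g L (F_ k) (H_ k)) ->
  F 1 - F 0 = 1 -> (forall k, F_ k 1 - F_ k 0 = 1) ->
  (forall t, `|g t| <= 1) ->
  (forall k t, 0 <= t <= 1 -> `|F_ k t - F t| <= 2 * 2^-1 ^+ k) ->
  (forall k, (k0 <= k)%N -> H_ k 1 - H_ k 0 = c) ->
  H 1 - H 0 = c.
Proof.
move=> HF HF_ F1 F_1 g1 FF Hc; apply/eqP; rewrite -subr_eq0 -normr_le0.
apply/ler_addgt0Pl => e e0; rewrite addr0.
have [N N0 NL] : exists2 N, (0 < N)%N & L / N%:R <= e / 4.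
  exists (Num.bound (4 * `|L| / e)).+1 => //.
  rewrite ler_pdivrMr// mulrC; apply: le_trans (ler_norm L) _.
  have L0 : 0 <= 4 * `|L| / e by rewrite divr_ge0 ?mulr_ge0// ltW.
  have := archi_boundP L0; rewrite ltr_pdivrMr//; set b := Num.bound _.
  rewrite (_ : b.+1%:R = b%:R + 1 :> R); last by rewrite natr1.
  by move: b%:R `|L| => B l; nra.
have dN : 0 < e / (8 * N%:R) by rewrite divr_gt0// mulr_gt0// ltr0n.
have [k1 k1P] := half_powers_small dN; pose k := maxn k0 k1.
have kP := k1P k (leq_maxr _ _); rewrite -(Hc k (leq_maxl _ _)).
have r1 := riemann_sum_error HF N0 F1; have r2 := riemann_sum_error (HF_ k) N0 (F_1 k).
set S := \sum_(j < N) _ in r1; set S' := \sum_(j < N) _ in r2.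
have SS : `|S' - S| <= e / 2.
  rewrite -sumrB; apply: le_trans (ler_norm_sum _ _ _) _.
  apply: (@le_trans _ _ (\sum_(j < N) 4 * 2^-1 ^+ k)).
    apply: ler_sum => j _; rewrite -mulrBr normrM.
    have b0 i : (i <= N)%N -> 0 <= (i%:R / N%:R : R) <= 1.
      by move=> iN; rewrite divr_ge0//= ler_pdivrMr ?ltr0n// mul1r ler_nat.
    apply: (@le_trans _ _ (1 * (4 * 2^-1 ^+ k))); last by rewrite mul1r.
    apply: ler_pM => //; have h1 := FF k _ (b0 j.+1 (ltn_ord j)).
    have h2 := FF k _ (b0 j (ltnW (ltn_ord j))).
    rewrite (_ : _ - _ = (F_ k (j.+1%:R / N%:R) - F (j.+1%:R / N%:R)) -
      (F_ k (j%:R / N%:R) - F (j%:R / N%:R))); last by ring.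
    apply: le_trans (ler_normB _ _) _; lra.
  rewrite sumr_const card_ord -[leLHS]mulr_natr.
  have : 2^-1 ^+ k * (8 * N%:R) <= e by rewrite -ler_pdivlMr ?mulr_gt0 ?ltr0n// ltW.
  lra.
rewrite (_ : _ - _ = (H 1 - H 0 - S) - (H_ k 1 - H_ k 0 - S') - (S' - S)); last by ring.
apply: le_trans (ler_normB _ _) _; apply: (@le_trans _ _ (e / 4 + e / 4 + e / 2)); last by lra.
by rewrite lerD// (le_trans (ler_normB _ _))// lerD// (le_trans _ NL).
Qed.

(** A primitive of [cos (w t + phi)]; for [w = 0] the division by [w] would
    give the value [0] instead. *)
Definition cos_primitive w phi t : R :=
  if w == 0 then cos phi * t else sin (w * t + phi) / w.

Lemma is_derive_cos_primitive w phi t :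
  is_derive t 1 (cos_primitive w phi) (cos (w * t + phi)).
Proof.
rewrite /cos_primitive; have [->|w0] := eqVneq w 0.
  rewrite mul0r add0r (_ : (fun _ => _) = cos phi *: id); last by apply/funext => s.
  by apply: is_derive_eq; rewrite /GRing.scale/= mulr1.
rewrite (_ : (fun _ => _) = w^-1 *: (sin \o (w *: id + cst phi))); last first.
  by apply/funext => s /=; rewrite mulrC.
have d1 : is_derive t 1 (w *: id + cst phi) w.
  by apply: is_derive_eq; rewrite addr0 /GRing.scale/= mulr1.
have d2 := is_derive1_comp (@is_derive_sin R ((w *: id + cst phi) t)) d1.
have d3 : is_derive t 1 (w^-1 *: (sin \o (w *: id + cst phi)))
    (w^-1 *: (cos ((w *: id + cst phi) t) * w)).
  exact: is_deriveZ.
apply: is_derive_eq; rewrite /GRing.scale/= mulrC mulfK//.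
Qed.

End stieltjes_comparison.

Section cosine_distribution.
Context (R : realType).
Implicit Types (a : nat -> R) (D p : nat) (x y t phi : R).

(** Primitive of [cos (2 pi p t + phi)] times the density with coefficients
    [a]; for [p = 0] and [phi = 0] it is the distribution function itself. *)
Definition cos_cdf a D p phi t : R :=
  \sum_(i < D.*2.+1) a (dist i D) * cos_primitive (2 * pi * (i%:R - D%:R + p%:R)) phi t.

Lemma is_derive_cos_cdf a D p phi t :
  is_derive t 1 (cos_cdf a D p phi) (cos (2 * pi * p%:R * t + phi) * sym_sum a D (2 * pi * t) 0).
Proof.
rewrite -sym_sum_phase.
rewrite (_ : cos_cdf a D p phi = \sum_(i < D.*2.+1)
    a (dist i D) *: cos_primitive (2 * pi * (i%:R - D%:R + p%:R)) phi); last first.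
  by apply/funext => s; rewrite fct_sumE.
rewrite /sym_sum; apply: is_derive_eq.
  apply: is_derive_sum => i; apply: is_deriveZ.
  exact: is_derive_cos_primitive.
by apply: eq_bigr => i _; rewrite /GRing.scale/=; congr (_ * cos _); ring.
Qed.

Lemma is_derive_lin (H F : R -> R) (s c h f t : R) :
  is_derive t 1 H h -> is_derive t 1 F f ->
  is_derive t 1 (fun t => s * H t + c * F t) (s * h + c * f).
Proof.
by move=> dH dF; exact: (is_deriveD (is_deriveZ s dH) (is_deriveZ c dF)).
Qed.

(** Where the density is nonnegative, [s (H - g(x) F) - L (y - x) F] has a
    nonpositive derivative between [x] and [y] for both signs [s]. *)
Lemma cos_cdf_primitive a D p phi : (forall t, 0 <= sym_sum a D t 0) ->
  stieltjes_primitive (fun t => cos (2 * pi * p%:R * t + phi)) (2 * pi * p%:R)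
    (cos_cdf a D 0 0) (cos_cdf a D p phi).
Proof.
move=> a0 x y _ xy _; pose g t := cos (2 * pi * p%:R * t + phi).
rewrite -/(g x); set L := 2 * pi * p%:R.
have L0 : 0 <= L by rewrite !mulr_ge0// pi_ge0.
set F := cos_cdf a D 0 0; set H := cos_cdf a D p phi.
pose f t := sym_sum a D (2 * pi * t) 0.
have dF t : is_derive t 1 F (f t).
  by apply: is_derive_eq; [exact: is_derive_cos_cdf|rewrite mulr0 mul0r addr0 cos0 mul1r].
have dH t : is_derive t 1 H (g t * f t) by exact: is_derive_cos_cdf.
have main (s : R) : `|s| = 1 -> s * (H y - H x - g x * (F y - F x)) <= L * (y - x) * (F y - F x).
  move=> s1; pose K t := s * H t + (- (s * g x) - L * (y - x)) * F t.
  have dK t : is_derive t 1 K (f t * (s * (g t - g x) - L * (y - x))).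
    have := is_derive_lin s (- (s * g x) - L * (y - x)) (dH t) (dF t).
    by congr is_derive; move: (f t) (g t) (g x) (L) => ft gt gx l; ring.
  have [c [xc cy E]] := mvt_le dK xy.
  have {E} : K y - K x <= 0.
    rewrite E mulr_le0_ge0 ?subr_ge0// mulr_ge0_le0 ?a0// subr_le0.
    apply: le_trans (ler_norm _) _; rewrite normrM s1 mul1r.
    apply: le_trans (cos_lipschitz _ _) _.
    rewrite (_ : _ - _ = L * (c - x)); last by rewrite /L; ring.
    by rewrite normrM !ger0_norm ?subr_ge0// ler_wpM2l// lerD2r.
  have -> : K y - K x = s * (H y - H x - g x * (F y - F x)) - L * (y - x) * (F y - F x).
    by rewrite /K; move: (H y) (H x) (g x) (F y) (F x) (L) => h h' gx k k' l; ring.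
  by rewrite subr_le0.
rewrite ler_norml; apply/andP; split.
  by have := main (-1); rewrite normrN1 => /(_ erefl); lra.
by have := main 1; rewrite normr1 mul1r => /(_ erefl).
Qed.

Lemma sinD2piX n t : sin (t + 2 * pi * n%:R) = sin t.
Proof.
have := periodicn (@sinD2pi R) n t; rewrite -[RHS]/(sin t) => <-; congr sin.
by congr (_ + _); rewrite -[RHS]mulr_natr -[pi *+ 2]mulr_natl.
Qed.

Lemma cos_primitive_period i j phi :
  cos_primitive (2 * pi * (i%:R - j%:R)) phi 1 - cos_primitive (2 * pi * (i%:R - j%:R)) phi 0 =
  (i == j)%:R * cos phi.
Proof.
rewrite /cos_primitive; have [->|ij] := eqVneq i j.
  by rewrite subrr mulr0 eqxx mulr1 mulr0 subr0 mul1r.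
have w0 : 2 * pi * (i%:R - j%:R) != 0 :> R.
  by rewrite mulf_neq0 ?subr_eq0 ?eqr_nat// mulf_neq0 ?pnatr_eq0// lt0r_neq0// pi_gt0.
rewrite (negbTE w0).
rewrite -mulrBl mul0r mulr1 mulr0 add0r.
have -> : 2 * pi * (i%:R - j%:R) + phi = phi - 2 * pi * j%:R + 2 * pi * i%:R by ring.
by rewrite sinD2piX -(sinD2piX j (phi - _)) subrK subrr mul0r.
Qed.

Lemma cos_cdf_total a D p phi : (p <= D)%N ->
  cos_cdf a D p phi 1 - cos_cdf a D p phi 0 = a p * cos phi.
Proof.
move=> pD; rewrite /cos_cdf -sumrB.
have iP : (D - p < D.*2.+1)%N by lia.
rewrite (bigD1 (Ordinal iP))//= big1 => [|i iD].
  rewrite -mulrBr addr0 addrAC -natrD cos_primitive_period subnK// eqxx mul1r.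
  by rewrite (_ : dist _ _ = p)// /dist; lia.
have ne : (i + p == D)%N = false.
  by apply/negbTE; apply: contra iD => /eqP iD; apply/eqP/val_inj => /=; lia.
by rewrite -mulrBr addrAC -natrD cos_primitive_period ne mul0r mulr0.
Qed.

(** Cosine integrals of a measure on [0, 1] whose distribution function is a
    uniform limit of those of positive cosine polynomials with stable
    coefficients. *)
Lemma int_cos (mu : {measure set (measurableTypeR R) -> \bar R}) (F : R -> R)
    a (D_ : nat -> nat) p phi :
  (forall x y, 0 <= x -> x <= y -> y <= 1 -> mu `]x, y]%classic = (F y - F x)%:E) ->
  mu [set 0] = 0%E -> F 1 - F 0 = 1 -> a 0%N = 1 ->
  (forall k t, 0 <= sym_sum a (D_ k) t 0) -> (forall k, (k <= D_ k)%N) ->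
  (forall k t, 0 <= t <= 1 -> `|cos_cdf a (D_ k) 0 0 t - F t| <= 2 * 2^-1 ^+ k) ->
  (\int[mu]_(t in `[0, 1]%classic) cos (2 * pi * p%:R * t + phi))%R = a p * cos phi.
Proof.
move=> muF mu0 F1 a0 apos kD aF; set g := fun t => cos (2 * pi * p%:R * t + phi).
have cg : continuous g.
  move=> t; apply: continuous_comp; last exact: continuous_cos.
  by apply: cvgD; [apply: cvgMr; exact: cvg_id|exact: cvg_cst].
have mg (A : set (measurableTypeR R)) : measurable_fun A g.
  by apply: measurable_funTS; exact: continuous_measurable_fun.
have g1 t : `|g t| <= 1 by rewrite ler_norml cos_geN1 cos_le1.
have ig A : measurable A -> (mu A < +oo)%E -> mu.-integrable A (EFin \o g).
  move=> mA muA; apply: measurable_bounded_integrable => //.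
  by exists 1; split => // M M1 t _ /=; exact: le_trans (g1 t) (ltW M1).
pose H t : R := (\int[mu]_(s in `]0%R, t]%classic) g s)%R.
have HB x y : 0 <= x -> x <= y -> y <= 1 ->
    H y - H x = (\int[mu]_(s in `]x, y]%classic) g s)%R.
  move=> x0 xy y1; rewrite /H.
  have -> : `]0%R, y]%classic = `]0%R, x]%classic `|` `]x, y]%classic :> set R.
    apply/seteqP; split=> s /=; rewrite !in_itv/=.
      by move=> /andP[s0 sy]; case: (leP s x) => sx; [left|right]; apply/andP.
    by move=> [] /andP[s0 sy]; apply/andP; split=> //; [exact: le_trans xy|exact: le_lt_trans s0].
  rewrite Rintegral_setU//; first by rewrite addrC addKr.
  - apply: ig; first exact: measurableU.
    rewrite -itv_bndbnd_setU ?bnd_simp// muF ?ltry//. exact: le_trans xy.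
  - apply/disj_setPS => s [/=]; rewrite !in_itv/= => /andP[_ sx] /andP[xs _].
    by have := le_lt_trans sx xs; rewrite ltxx.
have HF : stieltjes_primitive g (2 * pi * p%:R) F H.
  move=> x y x0 xy y1; rewrite HB//; set I := `]x, y]%classic.
  have muI : mu I = (F y - F x)%:E by exact: muF.
  have mI : measurable (I : set (measurableTypeR R)) by exact: measurable_itv.
  have I_fin : (mu I < +oo)%E by rewrite muI ltry.
  have -> : g x * (F y - F x) = (\int[mu]_(s in I) cst (g x) s)%R.
    by rewrite Rintegral_cst// muI.
  have icst (c : R) : mu.-integrable I (EFin \o cst c).
    apply: measurable_bounded_integrable => //.
    by exists `|c|; split => // M cM t _ /=; exact: ltW.
  rewrite -RintegralB//; last exact: ig.
  apply: le_trans (le_normr_Rintegral _ _) _ => //.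
    exact: (integrableB mI (ig _ mI I_fin) (icst (g x))).
  have -> : 2 * pi * p%:R * (y - x) * (F y - F x) =
      (\int[mu]_(s in I) cst (2 * pi * p%:R * (y - x)) s)%R.
    by rewrite Rintegral_cst// muI.
  apply: le_Rintegral => //.
    exact: (integrable_norm (integrableB mI (ig _ mI I_fin) (icst (g x)))).
  move=> s; rewrite /I /= in_itv/= => /andP[xs sy].
  apply: le_trans (cos_lipschitz _ _) _.
  rewrite (_ : _ - _ = 2 * pi * p%:R * (s - x)); last by ring.
  rewrite normrM !ger0_norm ?subr_ge0 ?(ltW xs)// ?mulr_ge0// ?pi_ge0//.
  by rewrite ler_wpM2l ?mulr_ge0// ?pi_ge0// lerD2r.
have total k : cos_cdf a (D_ k) 0 0 1 - cos_cdf a (D_ k) 0 0 0 = 1.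
  by rewrite cos_cdf_total// a0 cos0 mulr1.
have := stieltjes_limit HF (fun k => cos_cdf_primitive p phi (apos k)) F1 total g1 aF
  (fun k pk => cos_cdf_total a phi (leq_trans pk (kD k))).
rewrite HB// => <-.
have -> : `[0%R, 1%R]%classic = [set 0%R] `|` `]0%R, 1%R]%classic :> set R.
  by rewrite setU1itv ?bnd_simp.
have m0 : measurable ([set 0] : set (measurableTypeR R)) by exact: measurable_set1.
have fin0 : (mu [set 0%R] < +oo)%E by rewrite mu0 ltry.
have fin1 : (mu `]0%R, 1%R]%classic < +oo)%E by rewrite muF// ltry.
rewrite Rintegral_setU//; last 2 first.
- apply: ig; first exact: measurableU.
  by apply: le_lt_trans (measureU2 _ _ _) _ => //; exact: lte_add_pinfty.
- by apply/disj_setPS => s [/= ->]; rewrite in_itv/= ltxx.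
rewrite [X in X + _](_ : _ = 0) ?add0r//.
by rewrite /Rintegral null_set_integral//; apply/measurable_EFinP; exact: mg.
Qed.

End cosine_distribution.

(** * The singular measure on the interval *)

Section limit_distribution.
Context (R : realType).
Implicit Types (x y t : R).

(** The intervals of center [u k] and radius [2 * 2 ^- k] are nested. *)
Lemma nested_limit (u : nat -> R) :
  (forall k, `|u k.+1 - u k| <= 2^-1 ^+ k) ->
  exists l, forall k, `|u k - l| <= 2 * 2^-1 ^+ k.
Proof.
move=> uS; pose v k := u k - 2 * 2^-1 ^+ k; pose w k := u k + 2 * 2^-1 ^+ k.
have step k : v k <= v k.+1 /\ w k.+1 <= w k.
  have := uS k; rewrite ler_norml /v /w exprS => /andP[].
  by move: (2^-1 ^+ k) => e; split; lra.
have vw k : v k <= w k.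
  by rewrite lerD2l ge0_cp// mulr_ge0// exprn_ge0// invr_ge0.
have v_mono i j : (i <= j)%N -> v i <= v j.
  move=> ij; rewrite -(subnKC ij); elim: (j - i)%N => [|d IH]; first by rewrite addn0.
  by rewrite addnS (le_trans IH)// (step _).1.
have w_mono i j : (i <= j)%N -> w j <= w i.
  move=> ij; rewrite -(subnKC ij); elim: (j - i)%N => [|d IH]; first by rewrite addn0.
  by rewrite addnS (le_trans _ IH)// (step _).2.
have vw2 i j : v i <= w j.
  apply: le_trans (v_mono _ _ (leq_maxl i j)) _.
  exact: le_trans (vw _) (w_mono _ _ (leq_maxr i j)).
exists (sup (range v)) => k; rewrite ler_distlC; apply/andP; split.
  by apply: ub_le_sup; [exists (w 0%N) => _ [i _ <-]|exists k].
by apply: ge_sup; [exists (v 0%N), 0%N|move=> _ [i _ <-]; exact: vw2].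
Qed.

Lemma stieltjes_measure_itv (f : cumulative R R) x y : x <= y ->
  lebesgue_stieltjes_measure f `]x, y]%classic = (f y - f x)%:E.
Proof.
move=> xy; rewrite /lebesgue_stieltjes_measure /measure_extension.
by rewrite measurable_mu_extE/= ?wlength_itv_bnd//; exact: is_ocitv.
Qed.

Lemma exists_stieltjes_probability (G : R -> R) :
  {homo G : x y / x <= y} -> continuous G ->
  (forall x, x <= 0 -> G x = 0) -> (forall x, 1 <= x -> G x = 1) ->
  exists mu : probability (measurableTypeR R) R,
    forall x y, x <= y -> mu `]x, y]%classic = (G y - G x)%:E.
Proof.
move=> G_mono cG G0 G1.
have G_ny : G @ -oo --> (0 : R).
  apply: cvg_near_cst; near=> x; apply: G0; near: x; exact: nbhs_ninfty_le.
have G_y : G @ +oo --> (1 : R).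
  apply: cvg_near_cst; near=> x; apply: G1; near: x; exact: nbhs_pinfty_ge.
pose m1 := isCumulative.Build R _ R G G_mono (right_continuousW cG).
pose m2 := isCumulativeBounded.Build R 0 1 G G_ny G_y.
pose G' : cumulativeBounded 0 1 := HB.pack G m1 m2.
exists (lebesgue_stieltjes_measure G') => x y xy.
exact: (stieltjes_measure_itv G' xy).
Unshelve. all: by end_near. Qed.

Definition clamp t : R := Num.min (Num.max t 0) 1.

Lemma clamp_id t : 0 <= t <= 1 -> clamp t = t.
Proof. by move=> /andP[t0 t1]; rewrite /clamp max_l// min_l. Qed.

Lemma clamp_mono x y : x <= y -> clamp x <= clamp y <= clamp x + (y - x).
Proof.
move=> xy; rewrite /clamp !minElt !maxElt.
by case: (ltP x 0) => ?; case: (ltP y 0) => ?; rewrite ?ltr01;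
   case: (ltP x 1) => ?; case: (ltP y 1) => ?; apply/andP; split; lra.
Qed.

Lemma clamp_lipschitz x y : `|clamp y - clamp x| <= `|y - x|.
Proof.
wlog xy : x y / x <= y.
  move=> H; have [/H//|/ltW/H] := leP x y.
  by rewrite distrC [leRHS]distrC.
have /andP[xy1 xy2] := clamp_mono xy.
by rewrite !ger0_norm ?subr_ge0// lerBlDl.
Qed.

End limit_distribution.

Section trig_measure.
Context (R : realType) (m : nat -> nat -> nat).
Implicit Types (x y t phi : R).

Local Notation deg := (trig_deg m).
Local Notation scale := (trig_scale m).
Local Notation len := (trig_len m).
Local Notation a := (trig_coef R m).

Hypothesis mP : forall k, 2^-1 ^+ scale k * (len k)%:R <= 4^-1 ^+ k :> R.

Let Fk k : R -> R := cos_cdf a (deg k) 0 0.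

Lemma trig_scale_small k : 2^-1 ^+ scale k <= 2^-1 ^+ k :> R.
Proof.
apply: le_trans (_ : 4^-1 ^+ k <= _); last first.
  by rewrite lerXn2r ?nnegrE ?invr_ge0// lef_pV2 ?posrE// ler_nat.
apply: le_trans (mP k); rewrite ler_peMr ?exprn_ge0 ?invr_ge0//.
by rewrite ler1n.
Qed.

Lemma cos_primitive_small n t : (0 < n)%N ->
  `|cos_primitive (2 * pi * n%:R) 0 t| <= n%:R^-1.
Proof.
move=> n0; have w0 : 0 < 2 * pi * n%:R :> R by rewrite !mulr_gt0 ?pi_gt0// ltr0n.
rewrite /cos_primitive gt_eqF// normrM normfV (gtr0_norm w0).
apply: (@le_trans _ _ (1 * (2 * pi * n%:R)^-1)).
  by rewrite ler_wpM2r ?invr_ge0 ?sin_max// ltW.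
rewrite mul1r lef_pV2 ?posrE ?ltr0n// ler_peMl//.
by have := pi_ge2 R; lra.
Qed.

Lemma cos_primitiveN w t : cos_primitive (- w) 0 t = cos_primitive w 0 t.
Proof.
by rewrite /cos_primitive oppr_eq0; case: eqP => // _; rewrite !addr0 mulNr sinN invrN mulrNN.
Qed.

(** The new frequencies of stage [k] with a nonzero coefficient exceed
    [4 ^ m * len k], which is also their number up to a constant factor:
    dividing by the frequency compensates the number of terms, and the size of
    the coefficients is left. *)
Lemma trig_cdf_increment k t : `|Fk k.+1 t - Fk k t| <= 2^-1 ^+ k.
Proof.
pose G z := cos_primitive (2 * pi * z) 0 t.
have GN z : G (- z) = G z by rewrite /G mulrN cos_primitiveN.
have FkE l : Fk l t = \sum_(i < (deg l).*2.+1) a (dist i (deg l)) * G (i%:R - (deg l)%:R).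
  by apply: eq_bigr => i _; rewrite addr0.
rewrite !FkE trig_degS centered_sum_add// addrAC subrr add0r.
set N := (4 ^ scale k * len k)%N.
have -> : (2 * 4 ^ scale k * len k = N + N)%N by rewrite -mulnA mul2n addnn.
have N0 : (0 < N)%N by rewrite muln_gt0 expn_gt0.
rewrite big_split_ord/= big1 ?add0r => [|u _]; last first.
  rewrite trig_coef_block; last by have := ltn_ord u; rewrite /N; lia.
  by rewrite /trig_factor ltn_divLR// ltn_ord mul0r mulr0 mul0r.
apply: le_trans (ler_norm_sum _ _ _) _.
apply: (@le_trans _ _ (\sum_(u < N) 2^-1 ^+ scale k / N%:R)); last first.
  rewrite sumr_const card_ord -[leLHS]mulr_natr divfK ?trig_scale_small//.
  by rewrite pnatr_eq0 -lt0n.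
apply: ler_sum => u _; rewrite !normrM.
have := @norm_trig_coef_block R m k (N + u)%N; rewrite mulnAC.
have -> : (N + u < 2 * len k * 4 ^ scale k)%N by have := ltn_ord u; rewrite /N; lia.
move=> /(_ isT) ca.
have cG : `|G ((deg k).+1 + (N + u))%:R| <= N%:R^-1.
  apply: le_trans (cos_primitive_small t _) _ => //.
  by rewrite lef_pV2 ?posrE ?ltr0n// ler_nat; lia.
apply: ler_pM => //; rewrite (@ger0_norm _ 2)//.
have : 0 <= 2^-1 ^+ scale k :> R by rewrite exprn_ge0// invr_ge0.
by move: (2^-1 ^+ _) ca => e; lra.
Qed.

Lemma trig_cdf_mono k x y : x <= y -> Fk k x <= Fk k y.
Proof.
move=> xy; have dF t := is_derive_cos_cdf a (deg k) 0 0 t.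
have [c [_ _ E]] := mvt_le dF xy; rewrite -subr_ge0 E mulr_ge0 ?subr_ge0//.
by rewrite mulr0 mul0r addr0 cos0 mul1r; exact: trig_partial_pos.
Qed.

Lemma trig_cdf_continuous k : continuous (Fk k).
Proof.
move=> t; apply/differentiable_continuous/derivable1_diffP.
have dF := is_derive_cos_cdf a (deg k) 0 0 t; exact: ex_derive.
Qed.

Lemma cos_cdf0 b D : cos_cdf b D 0 0 (0 : R) = 0.
Proof.
rewrite /cos_cdf big1// => i _; rewrite /cos_primitive; case: eqP => _.
  by rewrite !mulr0.
by rewrite mulr0 addr0 sin0 mul0r mulr0.
Qed.

Lemma trig_cdf1 k : Fk k 1 = 1.
Proof.
have := @cos_cdf_total R a (deg k) 0 0 (leq0n _).
by rewrite cos_cdf0 subr0 trig_coef0 cos0 mulr1.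
Qed.

Lemma eq_of_close (u v : R) : (forall k, `|u - v| <= 2 * 2^-1 ^+ k) -> u = v.
Proof.
move=> H; apply/eqP; rewrite -subr_eq0 -normr_le0; apply/ler_addgt0Pl => e e0.
rewrite addr0; have [k kP] := half_powers_small (divr_gt0 e0 (ltr0Sn R 1)).
by apply: le_trans (H k) _; have := kP k (leqnn _); lra.
Qed.

(** The limit distribution function is made constant outside of [0, 1] before
    it is turned into a measure on the line. *)
Lemma exists_trig_measure : exists (mu : probability (measurableTypeR R) R) (F : R -> R),
  [/\ (forall x y, 0 <= x -> x <= y -> y <= 1 -> mu `]x, y]%classic = (F y - F x)%:E),
      mu [set 0] = 0%E, mu `[0, 1]%classic = 1%E, F 1 - F 0 = 1
    & forall k t, 0 <= t <= 1 -> `|Fk k t - F t| <= 2 * 2^-1 ^+ k].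
Proof.
have [F FP] := choice (fun t => nested_limit (fun k => trig_cdf_increment k t)).
have F_close k t : `|F t - Fk k t| <= 2 * 2^-1 ^+ k by rewrite distrC; exact: FP.
have F0 : F 0 = 0 by apply: eq_of_close => k; have := F_close k 0; rewrite /Fk cos_cdf0.
have F1 : F 1 = 1 by apply: eq_of_close => k; have := F_close k 1; rewrite trig_cdf1.
have F_mono x y : x <= y -> F x <= F y.
  move=> xy; apply/ler_addgt0Pl => e e0.
  have [k /(_ k (leqnn _)) kP] := half_powers_small (divr_gt0 e0 (ltr0Sn R 3)).
  have := F_close k x; have := F_close k y; have := trig_cdf_mono k xy.
  by rewrite !ler_norml => ? /andP[? ?] /andP[? ?]; lra.
have F_cont : continuous F.
  move=> x; apply/cvgrPdist_le => e e0.
  have [k /(_ k (leqnn _)) kP] := half_powers_small (divr_gt0 e0 (ltr0Sn R 7)).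
  have /cvgrPdist_le /(_ (e / 4)) := @trig_cdf_continuous k x.
  rewrite divr_gt0// => /(_ isT); apply: filterS => t near_t.
  rewrite (_ : F x - F t = (F x - Fk k x) + (Fk k x - Fk k t) - (F t - Fk k t)); last by ring.
  apply: le_trans (ler_normB _ _) _.
  have := ler_normD (F x - Fk k x) (Fk k x - Fk k t).
  have := F_close k x; have := F_close k t; lra.
have [||||mu muP] := @exists_stieltjes_probability R (F \o @clamp R).
- by move=> x y xy /=; apply: F_mono; have /andP[] := clamp_mono xy.
- move=> x; apply: continuous_comp; last exact: F_cont.
  apply/cvgrPdist_le => e e0; near=> t; apply: le_trans (clamp_lipschitz _ _) _.
  by near: t; exact: cvgr_dist_le.
- by move=> x x0; rewrite /= /clamp max_r// min_l// ler01.
- by move=> x x1; rewrite /= /clamp max_l ?(le_trans ler01)// min_r.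
have c0 : clamp (0 : R) = 0 by rewrite clamp_id// lexx ler01.
have c1 : clamp (1 : R) = 1 by rewrite clamp_id// lexx ler01.
have muF x y : 0 <= x -> x <= y -> y <= 1 -> mu `]x, y]%classic = (F y - F x)%:E.
  move=> x0 xy y1; rewrite muP//= !clamp_id//; first by rewrite x0 (le_trans xy).
  by rewrite y1 (le_trans x0).
have mu0 : mu [set 0] = 0%E.
  apply/eqP; rewrite eq_le measure_ge0 andbT.
  apply: (@le_trans _ _ (mu `]-1, 0]%classic)).
    apply: le_measure; rewrite ?inE; [exact: measurable_set1|exact: measurable_itv|].
    by move=> x /= ->; rewrite in_itv/= lexx ltrN10.
  rewrite muP ?lerN10//= c0 (_ : clamp (-1) = 0) ?subrr//.
  by rewrite /clamp max_r ?lerN10// min_l// ler01.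
exists mu, F; split=> //.
- apply/eqP; rewrite eq_le probability_le1//=.
  apply: (@le_trans _ _ (mu `]0%R, 1%R]%classic)); first by rewrite muF// F1 F0 subr0.
  apply: le_measure; rewrite ?inE; [exact: measurable_itv|exact: measurable_itv|].
  by move=> x /=; rewrite !in_itv/= => /andP[/ltW -> ->].
- by rewrite F1 F0 subr0.
Unshelve. all: by end_near. Qed.

End trig_measure.

Section cosine_moments.
Context (R : realType) (rho : {measure set (measurableTypeR R) -> \bar R}) (b : nat -> R).
Local Notation D := (`[0%R, 1%R]%classic : set (measurableTypeR R)).
Hypothesis rho1 : rho D = 1%E.
Hypothesis int_b : forall p, (\int[rho]_(t in D) cos (2 * pi * p%:R * t))%R = b p.

Definition harmonic (p : nat) (t : R) : R := cos (2 * pi * p%:R * t).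

Lemma measurable_harmonic p : measurable_fun D (harmonic p).
Proof.
apply: measurable_funTS; apply: continuous_measurable_fun => t.
apply: continuous_comp; last exact: continuous_cos.
by apply: cvgMr; exact: cvg_id.
Qed.

Lemma norm_harmonic p t : `|harmonic p t| <= 1.
Proof. by rewrite ler_norml cos_geN1 cos_le1. Qed.

Lemma int_lincomb N (c : nat -> R) (g : nat -> R -> R) (C : R) :
  (forall v, measurable_fun D (g v)) -> (forall v t, `|g v t| <= C) ->
  (\int[rho]_(t in D) \sum_(v < N) c v * g v t)%R =
  \sum_(v < N) c v * (\int[rho]_(t in D) g v t)%R.
Proof.
move=> mg g1; have mD : measurable D by exact: measurable_itv.
rewrite (@Rintegral_sum_bounded _ _ _ rho D N (fun v t => c v * g v t) (fun v => `|c v| * C))//.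
- apply: eq_bigr => v _; rewrite RintegralZl//.
  exact: (@integrable_of_bounded _ _ _ rho D (g v) C mD rho1 (mg v) (fun t _ => g1 v t)).
- by move=> v; apply: measurable_funM.
- by move=> v t _; rewrite normrM ler_wpM2l.
Qed.

Lemma int_harmonic_mul p n : (p <= n)%N ->
  (\int[rho]_(t in D) (harmonic p t * harmonic n t))%R = 2^-1 * (b (n + p)%N + b (n - p)%N).
Proof.
move=> pn; have mD : measurable D by exact: measurable_itv.
have ih q : rho.-integrable D (EFin \o harmonic q).
  exact: (@integrable_of_bounded _ _ _ rho D _ 1 mD rho1 (measurable_harmonic q)
            (fun t _ => norm_harmonic q t)).
transitivity (\int[rho]_(t in D) (2^-1 * (harmonic (n + p) t + harmonic (n - p) t)))%R.
  apply: eq_Rintegral => t _; rewrite /harmonic natrD natrB//.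
  rewrite (_ : _ * (_ + _) * t = 2 * pi * n%:R * t + 2 * pi * p%:R * t); last by ring.
  rewrite (_ : _ * (_ - _) * t = 2 * pi * n%:R * t - 2 * pi * p%:R * t); last by ring.
  by rewrite cosD cosB; field.
rewrite RintegralZl//; last exact: (integrableD mD (ih _) (ih _)).
by rewrite RintegralD// -!int_b.
Qed.

End cosine_moments.

Section trig_theorem.
Context (R : realType) (m : nat -> nat -> nat).
Implicit Types (x y t phi : R).

Local Notation deg := (trig_deg m).
Local Notation scale := (trig_scale m).
Local Notation len := (trig_len m).
Local Notation a := (trig_coef R m).
Local Notation D := (`[0%R, 1%R]%classic : set (measurableTypeR R)).

Definition stage_freq (k v : nat) : nat := ((4 ^ scale k + v).+1 * len k)%N.

Definition stage_fun (k : nat) t : R := \sum_(v < 4 ^ scale k)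
  (2^-1 ^+ scale k * shapiro R false (scale k).*2 v) * harmonic (stage_freq k v) t.

Lemma stage_fun_bound k t : `|stage_fun k t| <= 5.
Proof.
have -> : stage_fun k t = 2^-1 ^+ scale k * trig_sum (shapiro R false (scale k).*2)
    (4 ^ scale k) (2 * pi * (len k)%:R * t) ((4 ^ scale k).+1%:R * (2 * pi * (len k)%:R * t)).
  rewrite /trig_sum mulr_sumr; apply: eq_bigr => v _; rewrite -mulrA; congr (_ * (_ * cos _)).
  by rewrite /stage_freq -addSn natrM natrD; ring.
rewrite normrM ger0_norm ?exprn_ge0 ?invr_ge0//.
apply: (@le_trans _ _ (2^-1 ^+ scale k * (5 * 2 ^+ scale k))).
  by rewrite ler_wpM2l ?exprn_ge0 ?invr_ge0// shapiro_le.
by rewrite mulrCA -exprMn mulVf ?pnatr_eq0// expr1n mulr1.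
Qed.

Lemma stage_freq_gt k v : (deg k < stage_freq k v)%N.
Proof. by rewrite /stage_freq /trig_len; nia. Qed.

Lemma stage_freq_le k v : (v < 4 ^ scale k)%N -> (stage_freq k v <= deg k.+1)%N.
Proof.
move=> vM; rewrite trig_degS /stage_freq; apply: leq_trans (leq_addl _ _).
by rewrite leq_pmul2r// mul2n -addnn -addnS leq_add2l.
Qed.

(** Around a frequency of the factor, the coefficients repeat those of the
    previous density, up to the coefficient of the factor. *)
Lemma trig_coef_near k v d : (v < 4 ^ scale k)%N -> (d <= deg k)%N ->
  a (stage_freq k v + d) = 16^-1 * 2^-1 ^+ scale k * shapiro R false (scale k).*2 v * a d /\
  a (stage_freq k v - d) = 16^-1 * 2^-1 ^+ scale k * shapiro R false (scale k).*2 v * a d.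
Proof.
move=> vM dk; have factorE :
    trig_factor R m k (4 ^ scale k + v) = 16^-1 * 2^-1 ^+ scale k * shapiro R false (scale k).*2 v.
  by rewrite /trig_factor ltnNge leq_addr/= addKn.
have H r : (r < len k)%N -> dist r (deg k) = d ->
    a ((deg k).+1 + ((4 ^ scale k + v) * len k + r))%N = trig_factor R m k (4 ^ scale k + v) * a d.
  move=> rL rd; rewrite trig_coef_block; last first.
    apply: leq_trans (_ : ((4 ^ scale k + v).+1 * len k <= _)%N).
      by rewrite mulSn [X in (_ < X)%N]addnC ltn_add2l.
    by rewrite leq_pmul2r// mul2n -addnn -addnS leq_add2l.
  by rewrite divnMDl// (divn_small rL) addn0 modnMDl (modn_small rL) rd.
rewrite -factorE; split.
- rewrite -(H (deg k + d)%N); [|by rewrite /trig_len; lia|by rewrite /dist; lia].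
  by congr trig_coef; rewrite /stage_freq mulSn /trig_len; lia.
- rewrite -(H (deg k - d)%N); [|by rewrite /trig_len; lia|by rewrite /dist; lia].
  by congr trig_coef; rewrite /stage_freq mulSn /trig_len; lia.
Qed.

Lemma shapiro_square_sum k :
  \sum_(v < 4 ^ scale k) (2^-1 ^+ scale k * shapiro R false (scale k).*2 v) *
    (16^-1 * 2^-1 ^+ scale k * shapiro R false (scale k).*2 v) = 16^-1.
Proof.
transitivity (\sum_(v < 4 ^ scale k) 16^-1 * (2^-1 ^+ scale k) ^+ 2 : R).
  apply: eq_bigr => v _; rewrite (_ : _ * _ = 16^-1 * (2^-1 ^+ scale k) ^+ 2 *
     shapiro R false (scale k).*2 v ^+ 2); last by ring.
  by rewrite -[_ ^+ 2 in X in _ * X = _]real_normK ?num_real// norm_shapiro expr1n mulr1.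
rewrite sumr_const card_ord -[LHS]mulr_natr natrX -mulrA -exprM mulnC exprM -exprMn.
by rewrite (_ : 2^-1 ^+ 2 * 4 = 1) ?expr1n ?mulr1//; field.
Qed.

Section moments.
Variables (rho : {measure set (measurableTypeR R) -> \bar R}) (b : nat -> R).
Hypothesis rho1 : rho D = 1%E.
Hypothesis int_b : forall p, (\int[rho]_(t in D) cos (2 * pi * p%:R * t))%R = b p.

Lemma int_stage k : (\int[rho]_(t in D) stage_fun k t)%R =
  \sum_(v < 4 ^ scale k) (2^-1 ^+ scale k * shapiro R false (scale k).*2 v) * b (stage_freq k v).
Proof.
rewrite (@int_lincomb R rho rho1 _ (fun v => 2^-1 ^+ scale k * shapiro R false (scale k).*2 v)
  (fun v => harmonic (stage_freq k v)) 1).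
- by apply: eq_bigr => v _; rewrite int_b.
- by move=> v; exact: measurable_harmonic.
- by move=> v t; exact: norm_harmonic.
Qed.

Lemma measurable_stage_fun k : measurable_fun D (stage_fun k).
Proof.
apply: (@measurable_sum _ _ _ _ _ _ (fun v : 'I_(4 ^ scale k) => fun t =>
  (2^-1 ^+ scale k * shapiro R false (scale k).*2 v) * harmonic (stage_freq k v) t)) => v.
by apply: measurable_funM => //; exact: measurable_harmonic.
Qed.

Lemma int_stage_mul k l : (k < l)%N ->
  (\int[rho]_(t in D) (stage_fun k t * stage_fun l t))%R =
  \sum_(w < 4 ^ scale l) (2^-1 ^+ scale l * shapiro R false (scale l).*2 w) *
  \sum_(v < 4 ^ scale k) (2^-1 ^+ scale k * shapiro R false (scale k).*2 v) *
    (2^-1 * (b (stage_freq l w + stage_freq k v)%N + b (stage_freq l w - stage_freq k v)%N)).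
Proof.
move=> kl.
transitivity (\int[rho]_(t in D) \sum_(w < 4 ^ scale l)
    (2^-1 ^+ scale l * shapiro R false (scale l).*2 w) *
    (stage_fun k t * harmonic (stage_freq l w) t))%R.
  apply: eq_Rintegral => t _; rewrite {2}/stage_fun mulr_sumr.
  by apply: eq_bigr => w _; rewrite mulrCA.
rewrite (@int_lincomb R rho rho1 _
  (fun w => 2^-1 ^+ scale l * shapiro R false (scale l).*2 w)
  (fun w t => stage_fun k t * harmonic (stage_freq l w) t) 5).
- apply: eq_bigr => w _; congr (_ * _).
  transitivity (\int[rho]_(t in D) \sum_(v < 4 ^ scale k)
      (2^-1 ^+ scale k * shapiro R false (scale k).*2 v) *
      (harmonic (stage_freq k v) t * harmonic (stage_freq l w) t))%R.
    apply: eq_Rintegral => t _; rewrite /stage_fun mulr_suml.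
    by apply: eq_bigr => v _; rewrite mulrA.
  rewrite (@int_lincomb R rho rho1 _
    (fun v => 2^-1 ^+ scale k * shapiro R false (scale k).*2 v)
    (fun v t => harmonic (stage_freq k v) t * harmonic (stage_freq l w) t) 1).
  + apply: eq_bigr => v _; congr (_ * _); apply: int_harmonic_mul => //.
    apply: leq_trans (stage_freq_le (ltn_ord v)) _.
    by apply: leq_trans (trig_deg_mono m kl) (ltnW (stage_freq_gt _ _)).
  + by move=> v; apply: measurable_funM; exact: measurable_harmonic.
  + by move=> v t; rewrite normrM mulr_ile1// norm_harmonic.
- by move=> w; apply: measurable_funM; [exact: measurable_stage_fun|exact: measurable_harmonic].
- move=> w t; rewrite normrM -[leRHS]mulr1.
  by apply: ler_pM => //; [exact: stage_fun_bound|exact: norm_harmonic].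
Qed.

End moments.

(** The mean and the correlations come out of the construction itself: near the
    frequencies of stage [l] the coefficients of [mu] are those of the factor
    times those of the previous density. *)
Lemma stage_mean (mu : {measure set (measurableTypeR R) -> \bar R}) k :
  mu D = 1%E -> (forall p, (\int[mu]_(t in D) cos (2 * pi * p%:R * t))%R = a p) ->
  (\int[mu]_(t in D) stage_fun k t)%R = 16^-1.
Proof.
move=> mu1 mua; rewrite (int_stage mu1 mua) -(shapiro_square_sum k).
apply: eq_bigr => v _; congr (_ * _).
by have [] := trig_coef_near (ltn_ord v) (leq0n (deg k)); rewrite addn0 trig_coef0 mulr1.
Qed.

Lemma stage_correlation (mu : {measure set (measurableTypeR R) -> \bar R}) k l :
  (k < l)%N ->
  mu D = 1%E -> (forall p, (\int[mu]_(t in D) cos (2 * pi * p%:R * t))%R = a p) ->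
  (\int[mu]_(t in D) (stage_fun k t * stage_fun l t))%R = 16^-1 ^+ 2.
Proof.
move=> kl mu1 mua; rewrite (int_stage_mul mu1 mua kl) expr2 -{1}(shapiro_square_sum l) mulr_suml.
apply: eq_bigr => w _; rewrite -[RHS]mulrA; congr (_ * _).
rewrite -[X in _ = _ * X](shapiro_square_sum k) mulr_sumr; apply: eq_bigr => v _.
have vl : (stage_freq k v <= deg l)%N.
  by apply: leq_trans (stage_freq_le (ltn_ord v)) (trig_deg_mono m kl).
have [-> ->] := trig_coef_near (ltn_ord w) vl.
have [+ _] := trig_coef_near (ltn_ord v) (leq0n (deg k)).
by rewrite addn0 trig_coef0 mulr1 => ->; field.
Qed.

(** Lebesgue measure is the case of the constant density. *)
Lemma lebesgue_int_cos p :
  (\int[@lebesgue_measure R]_(t in D) cos (2 * pi * p%:R * t))%R = (p == 0%N)%:R.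
Proof.
pose b0 n : R := (n == 0%N)%:R.
have cdf0 k t : cos_cdf b0 k 0 0 t = t.
  have kP : (k < k.*2.+1)%N by lia.
  rewrite /cos_cdf (bigD1 (Ordinal kP))//= big1 ?addr0 => [|i ik].
    rewrite (_ : dist k k = 0%N) ?/dist ?subnn// /b0 /cos_primitive subrr mulr0.
    by rewrite !eqxx cos0 !mul1r.
  rewrite /b0 (_ : dist i k == 0%N = false) ?mul0r//.
  apply/negbTE; apply: contra ik => /eqP; rewrite /dist => ik.
  by apply/eqP/val_inj => /=; lia.
have sum0 k t : sym_sum b0 k t 0 = 1.
  elim: k => [|k IH]; first by rewrite sym_sum0.
  by rewrite -addn1 sym_sum_add IH big_ord1 /b0 /= mulr0 mul0r addr0.
have := @int_cos R (@lebesgue_measure R) id b0 id p 0.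
rewrite cos0 mulr1 -/(b0 p) => <-//; first by apply: eq_Rintegral => t _; rewrite addr0.
- move=> x y x0 xy y1; apply: etrans (lebesgue_measure_itv `]x, y]) _; rewrite /= lte_fin.
  by case: ltP => // yx; rewrite (le_anti (_ : x <= y <= x)) ?subrr// xy yx.
- exact: lebesgue_measure_set1.
- by rewrite subr0.
- by move=> k t; rewrite sum0.
- by move=> k t _; rewrite cdf0 subrr normr0 mulr_ge0// exprn_ge0// invr_ge0.
Qed.

Lemma trig_singular (mu : probability (measurableTypeR R) R) : mu D = 1%E ->
  (forall p, (\int[mu]_(t in D) cos (2 * pi * p%:R * t))%R = a p) ->
  mutually_singular mu (@lebesgue_measure R).
Proof.
move=> mu1 mua; have mD : measurable D by exact: measurable_itv.
have leb1 : @lebesgue_measure R D = 1%E.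
  by apply: etrans (lebesgue_measure_itv `[0%R, 1%R]) _; rewrite /= lte_fin ltr01 oppr0 adde0.
have [||||A [mA AD muA lebA]] := @weak_law_singular _ _ R mu (@lebesgue_measure R) D
  stage_fun 16^-1 5 mD mu1 leb1 _ measurable_stage_fun (fun k t _ => stage_fun_bound k t).
- by [].
- by move=> k; apply: stage_mean.
- by move=> k l kl; apply: stage_correlation.
- move=> k l kl; rewrite (int_stage_mul leb1 lebesgue_int_cos kl).
  rewrite big1// => w _; rewrite big1 ?mulr0// => v _.
  have lt : (stage_freq k v < stage_freq l w)%N.
    apply: leq_ltn_trans (stage_freq_le (ltn_ord v)) _.
    by apply: leq_ltn_trans (trig_deg_mono m kl) (stage_freq_gt _ _).
  rewrite (_ : (_ + _ == _)%N = false); last by apply/negbTE; rewrite -lt0n; lia.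
  rewrite (_ : (_ - _ == _)%N = false); last by apply/negbTE; rewrite -lt0n subn_gt0.
  by rewrite addr0 !mulr0.
exists A; split=> //.
have -> : ~` A = (D `\` A) `|` ~` D.
  apply/seteqP; split=> [t nA|t [[] //|nD /AD //]].
  by have [Dt|nD] := pselect (D t); [left|right].
have mu_nD : mu (~` D) = 0%E by rewrite probability_setC// mu1 subee.
apply/eqP; rewrite eq_le measure_ge0 andbT -[leRHS]adde0 -{1}muA -mu_nD.
apply: measureU2; [exact: measurableD|exact: measurableC].
Qed.

End trig_theorem.

(** * Fourier coefficients and partial sums *)

Section fourier.
Context (R : realType) (a : nat -> R) (mu : probability (measurableTypeR R) R).
Local Notation D := (`[0%R, 1%R]%classic : set (measurableTypeR R)).
Hypothesis int_a : forall p phi,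
  (\int[mu]_(t in D) cos (2 * pi * p%:R * t + phi))%R = a p * cos phi.

Lemma fourier_coefE (n : int) : fourier_coef mu n = (a `|n|%N)%:C%C.
Proof.
have cosE (t : R) : cos (- (2 * pi * n%:~R * t)) = cos (2 * pi * `|n|%N%:R * t + 0).
  rewrite addr0 cosN; case: n => p; first by [].
  by rewrite NegzE abszN /= mulrNz mulrN mulNr cosN.
have sinE (t : R) : sin (- (2 * pi * n%:~R * t)) =
    cos (2 * pi * `|n|%N%:R * t + (if (0 <= n) then pi / 2 else - (pi / 2))).
  case: n {cosE} => p /=; first by rewrite cosDpihalf sinN.
  by rewrite NegzE mulrNz mulrN mulNr opprK cosBpihalf.
rewrite /fourier_coef /cintegral /expi /=; congr Complex.
  by under eq_Rintegral do rewrite cosE; rewrite int_a cos0 mulr1.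
under eq_Rintegral do rewrite sinE; rewrite int_a.
by case: ifP => _; rewrite ?cosN cos_pihalf mulr0.
Qed.

Lemma fourier_partial_sumE N t :
  fourier_partial_sum mu N t = (sym_sum a N (2 * pi * t) 0)%:C%C.
Proof.
have freqE (k : nat) : `|(k%:Z - N%:Z)%R|%N = dist k N by rewrite /dist; lia.
have -> : fourier_partial_sum mu N t =
    \sum_(k < N.*2.+1) Complex (a (dist k N) * cos ((k%:R - N%:R) * (2 * pi * t) + 0))
                               (a (dist k N) * cos ((k%:R - N%:R) * (2 * pi * t) - pi / 2)).
  apply: eq_bigr => k _; cbv zeta; rewrite fourier_coefE freqE /expi addr0 cosBpihalf.
  rewrite intrB !pmulrn; simpc.
  by congr (Complex (_ * cos _) (_ * sin _)); ring.
have sumC n (f g : nat -> R) : \sum_(k < n) Complex (f k) (g k) =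
    Complex (\sum_(k < n) f k) (\sum_(k < n) g k).
  elim: n => [|n IH]; first by rewrite !big_ord0.
  by rewrite !big_ord_recr/= IH; simpc.
rewrite (sumC _ (fun k => a (dist k N) * cos ((k%:R - N%:R) * (2 * pi * t) + 0))
  (fun k => a (dist k N) * cos ((k%:R - N%:R) * (2 * pi * t) - pi / 2))).
congr Complex; rewrite -/(sym_sum a N (2 * pi * t) (- (pi / 2))) sym_sum_phase.
by rewrite cosN cos_pihalf mul0r.
Qed.

End fourier.

Lemma trig_part (R : realType) (psi : R -> R) :
  {in `[0, +oo[ &, {homo psi : x y / x <= y}} -> (forall t, 0 <= t -> 0 <= psi t) ->
  psi x / x ^+ 2 @[x --> 0^'+] --> (0 : R) ->
  exists mu : probability (measurableTypeR R) R,
    [/\ mu `[0, 1]%classic = 1%E,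
        mutually_singular mu lebesgue_measure,
        forall (N : nat) (t : R), 0 <= t <= 1 -> 0 <= fourier_partial_sum mu N t
      & (\sum_(n <oo) (psi (ComplexField.Normc.normc (fourier_coef mu n%:Z)))%:E < +oo)%E].
Proof.
move=> psi_mono psi0 /scale_choice [m mP].
have m2 k : 2^-1 ^+ trig_scale m k * (trig_len m k)%:R <= 4^-1 ^+ k :> R.
  by have [] := mP k (trig_len m k).
have [mu [F [muF mu0 mu1 F1 FF]]] := exists_trig_measure m2.
have int_a p phi : (\int[mu]_(t in (`[0%R, 1%R]%classic : set (measurableTypeR R)))
    cos (2 * pi * p%:R * t + phi))%R = trig_coef R m p * cos phi.
  apply: (int_cos p phi muF mu0 F1 _ _ (trig_deg_ge m) FF); first exact: trig_coef0.
  by move=> k t; exact: trig_partial_pos.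
exists mu; split=> //.
- apply: (@trig_singular R m) => // p.
  have := int_a p 0; rewrite cos0 mulr1 => <-.
  by apply: eq_Rintegral => t _; rewrite addr0.
- move=> N t _; rewrite (fourier_partial_sumE int_a).
  by rewrite lecR; exact: trig_partial_pos.
- have := @trig_coef_summable R m psi psi_mono psi0.
  have psiP k : psi (2^-1 ^+ trig_scale m k) *
     (2 * trig_len m k * 4 ^ trig_scale m k)%:R <= 2^-1 ^+ k.
    by have [] := mP k (trig_len m k).
  move=> /(_ psiP); congr (_ < _)%E; apply: eq_eseriesr => n _; congr (psi _)%:E.
  rewrite (fourier_coefE int_a) /= expr0n/= addr0 sqrtr_sqr//.
Qed.

Unset Implicit Arguments.

Theorem mainTheorem2 (R : realType) (psi : R -> R)
  (psi_fun : set_fun `[0, +oo[ `[0, +oo[ psi)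
  (psi_onto : set_surj `[0, +oo[ `[0, +oo[ psi)
  (psi_nondecreasing : {in `[0, +oo[ &, {homo psi : x y / x <= y}})
  (psi_small : psi x / x ^+ 2 @[x --> 0^'+] --> (0 : R)) :
  (forall haar : probability dyadic R, is_haar haar ->
     exists mu : probability dyadic R,
       [/\ mutually_singular mu haar,
           forall (N : nat) (x : dyadic),
             0 <= \sum_(n < N.+1) walsh_coef mu n * walsh R n x
         & (\sum_(n <oo) (psi `|walsh_coef mu n|)%:E < +oo)%E])
  /\
  (exists mu : probability (measurableTypeR R) R,
     [/\ mu `[0, 1]%classic = 1%E,
         mutually_singular mu lebesgue_measure,
         forall (N : nat) (t : R), 0 <= t <= 1 ->
           0 <= fourier_partial_sum mu N t
       & (\sum_(n <oo) (psi (ComplexField.Normc.normc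
                               (fourier_coef mu n%:Z)))%:E < +oo)%E]).
Proof.
have psi0 t : 0 <= t -> 0 <= psi t.
  move=> t0; have t_in : `[0, +oo[%classic t by rewrite /= in_itv/= t0.
  by have := psi_fun t t_in; rewrite /= in_itv/= andbT.
by split=> [haar haarP|]; [exact: walsh_part|exact: trig_part].
Qed.
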